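(* Let $T\subset\mathbb{R}^2$ be a nondegenerate triangle with Clough--Tocher split $\mathcal{R}(T)$, and define $$A^0(T)=\mathrm{C}^1\mathrm{P}^3(\mathcal{R}(T),\mathbb{R}),\quad A^1(T)=\mathrm{H}^0_{\mathrm{div}}\mathrm{P}^1(\mathcal{R}(T),\mathbb{S}),\quad A^2(T)=\mathrm{P}^0(\mathcal{R}(T),\mathbb{V}),$$ with degrees of freedom (DoFs) as follows. - On $A^0(T)$: values at vertices ($3$), values of the gradient at vertices ($3\times2$), integrals of the normal derivative on edges ($3$). - On $A^1(T)$: for each edge $E$, $u\mapsto\int_Eu\nu\cdot v$ for $v\in\mathrm{P}^1(E,\mathbb{V})$ ($3\times4$), and $u\mapsto\int_Tu\cdot v$ for $v\in\mathrm{P}^0(T,\mathbb{S})$ ($3$). - On $A^2(T)$: $u\mapsto\int_Tu\cdot v$ for $v\in\mathrm{P}^1(T,\mathbb{V})$ ($6$). Then: 1. $A^0(T)$ has dimension $12$ and the provided DoFs are unisolvent. 2. $A^1(T)$ has dimension $15$ and the provided DoFs are unisolvent. 3. $A^2(T)$ has dimension $6$ and the provided DoFs are unisolvent. 4. The complex $A^0(T)\xrightarrow{\mathrm{airy}}A^1(T)\xrightarrow{\mathrm{div}}A^2(T)$ is a resolution of the affine functions, i.e. $0\to\mathrm{P}^1(T,\mathbb{R})\to A^0(T)\to A^1(T)\to A^2(T)\to0$ is exact.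
   Context: $\mathbb{V}=\mathbb{R}^2$ (column vectors), $\mathbb{S}$ is the space of symmetric $2\times2$ real matrices (with the Frobenius inner product). For a scalar field, $\mathrm{airy}\,u=\begin{pmatrix}\partial_{22}u&-\partial_{21}u\\-\partial_{12}u&\partial_{11}u\end{pmatrix}$. The divergence of a matrix field is taken row-wise: $(\mathrm{div}\,u)_i=\partial_1u_{i1}+\partial_2u_{i2}$. The Clough--Tocher split $\mathcal{R}(T)$ is the subdivision of $T$ into three triangles obtained by joining an interior point of $T$ to the three vertices of $T$. $\mathrm{P}^r$ denotes polynomials of degree at most $r$, and $\mathrm{P}^r(\mathcal{R}(T),\cdot)$ fields that are piecewise $\mathrm{P}^r$ with respect to $\mathcal{R}(T)$. $\mathrm{C}^1\mathrm{P}^3(\mathcal{R}(T),\mathbb{R})$: those of class $\mathrm{C}^1$ on $T$ (the Clough--Tocher space). $\mathrm{H}^0_{\mathrm{div}}\mathrm{P}^1(\mathcal{R}(T),\mathbb{S})$: symmetric matrix fields, piecewise polynomial of degree at most $1$, with continuous normal components $un$ across interior edges of $\mathcal{R}(T)$ with normal $n$ (i.e. with divergence in $\mathrm{L}^2$). For an edge $E$ of $T$, $\nu$ is a unit normal to $E$. A set of DoFs on a finite-dimensional space $A$ is unisolvent if the listed linear forms (bases being chosen for the test functions) form a basis of the dual $A^\star$. *)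

(* Defs.v *)
From HB Require Import structures.
From mathcomp Require Import all_boot all_order all_algebra.
From mathcomp Require Import all_classical all_reals all_analysis.

Set Implicit Arguments.
Unset Strict Implicit.
Unset Printing Implicit Defensive.

Import Order.TTheory GRing.Theory Num.Theory.
Import numFieldNormedType.Exports.

Local Open Scope classical_set_scope.
Local Open Scope ring_scope.

(* All spaces are linear subspaces of function spaces. These are not
   [vectType]s, so bases, dimensions and duals are spelled out for a subspace
   [A] given as a set of vectors of an arbitrary [lmodType]. *)

Definition is_basis (R : realType) (E : lmodType R) (I : finType)
    (A : set E) (b : I -> E) : Prop :=
  (forall i, A (b i)) /\
  forall u, A u -> exists! c : {ffun I -> R}, u = \sum_i c i *: b i.

Definition has_dim (R : realType) (E : lmodType R) (A : set E) (n : nat) :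
  Prop := exists b : 'I_n -> E, is_basis A b.

Definition dual_space (R : realType) (E : lmodType R) (A : set E) : set (A -> R) :=
  [set f | forall (k : R) (u v w : A),
    val w = k *: val u + val v -> f w = k * f u + f v].
Arguments dual_space {R E} A _.

Definition unisolvent (R : realType) (E : lmodType R) (I : finType)
    (A : set E) (l : I -> E -> R) : Prop :=
  is_basis (dual_space A) (fun i (u : A) => l i (val u)).

(* On column vectors this is the Euclidean product, on square matrices the
   Frobenius product. *)
Definition dot (R : realType) (m n : nat) (A B : 'M[R]_(m, n)) : R :=
  \tr (A^T *m B).

Definition conv_hull (R : realType) (a : 'I_3 -> 'cV[R]_2) : set 'cV[R]_2 :=
  [set x | exists c : 'I_3 -> R,
    [/\ forall i, 0 <= c i, \sum_i c i = 1 & x = \sum_i c i *: a i]].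

Definition nondegenerate_triangle (R : realType) (a : 'I_3 -> 'cV[R]_2) : Prop :=
  free [:: a 1 - a 0; a 2%:R - a 0].

(* The Clough--Tocher split of the triangle [a] by the point [z]: the [i]-th
   subtriangle has its vertex [a i] replaced by [z]. Indices in ['I_3] are
   cyclic, so the subtriangles containing [a k] are those of index [k + 1] and
   [k + 2], and the edge opposite to [a i] belongs to subtriangle [i]. *)
Definition CT (R : realType) (a : 'I_3 -> 'cV[R]_2) (z : 'cV[R]_2)
    (i : 'I_3) : set 'cV[R]_2 :=
  conv_hull (fun j => if j == i then z else a j).

Definition seg (R : realType) (p q : 'cV[R]_2) (t : R) : 'cV[R]_2 :=
  p + t *: (q - p).

Definition edge_vec (R : realType) (a : 'I_3 -> 'cV[R]_2) (i : 'I_3) :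
  'cV[R]_2 := a (i + 2%:R) - a (i + 1).

Definition edge_pt (R : realType) (a : 'I_3 -> 'cV[R]_2) (i : 'I_3) (t : R) :
  'cV[R]_2 := seg (a (i + 1)) (a (i + 2%:R)) t.

Definition edge (R : realType) (a : 'I_3 -> 'cV[R]_2) (i : 'I_3) :
  set 'cV[R]_2 := edge_pt a i @` `[0, 1].

Definition unit_normal (R : realType) (n e : 'cV[R]_2) : Prop :=
  dot n n = 1 /\ dot n e = 0.

(* Arc-length integral over an edge, through its affine parametrization. *)
Definition edge_int (R : realType) (a : 'I_3 -> 'cV[R]_2) (i : 'I_3)
    (f : 'cV[R]_2 -> R) : R :=
  Num.sqrt (dot (edge_vec a i) (edge_vec a i)) *
  \int[lebesgue_measure]_(t in `[0, 1]) f (edge_pt a i t).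

Definition pt (R : realType) (x : R * R) : 'cV[R]_2 :=
  \col_i (if i == 0 then x.1 else x.2).

(* Lebesgue integral on a region of the plane. *)
Definition area_int (R : realType) (D : set 'cV[R]_2) (f : 'cV[R]_2 -> R) : R :=
  \int[(@lebesgue_measure R \x @lebesgue_measure R)%E]_(x in @pt R @^-1` D)
    f (pt x).

Definition partial (R : realType) (j : 'I_2) (f : 'cV[R]_2 -> R) :
  'cV[R]_2 -> R := fun x => 'D_(delta_mx j 0) f x.

Definition is_poly (R : realType) (r : nat) : set ('cV[R]_2 -> R) :=
  [set f | exists c : nat -> nat -> R, forall x : 'cV[R]_2,
    f x = \sum_(i < r.+1) \sum_(j < r.+1 | (i + j <= r)%N)
            c i j * x 0 0 ^+ i * x 1 0 ^+ j].

Definition is_polymx (R : realType) (m n r : nat) :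
  set ('cV[R]_2 -> 'M[R]_(m, n)) :=
  [set f | forall i j, is_poly r (fun x => f x i j)].

(* Spaces of test functions on a set [D]: restrictions to [D] of polynomial
   fields, extended by zero outside [D]. *)

Definition P_V (R : realType) (r : nat) (D : set 'cV[R]_2) :
  set ('cV[R]_2 -> 'cV[R]_2) := [set patch (cst 0) D p | p in @is_polymx R 2 1 r].

Definition P_S (R : realType) (r : nat) (D : set 'cV[R]_2) :
  set ('cV[R]_2 -> 'M[R]_2) :=
  [set patch (cst 0) D p | p in [set p | @is_polymx R 2 2 r p /\
                              forall x, (p x)^T = p x]].

(* A field that is piecewise polynomial with respect to the Clough--Tocher
   split is given by its three polynomial pieces: [u i] is the polynomial (on
   the whole plane) that agrees with the field on the subtriangle [CT a z i].
   It need not have a value on the interior edges. *)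

(* f is continuous on T, and its partial derivatives exist in the interior of T
   and extend continuously to T. *)
Definition C1_on (R : realType) (T : set 'cV[R]_2) (f : 'cV[R]_2 -> R) : Prop :=
  {within T, continuous f} /\
  exists g : 'I_2 -> 'cV[R]_2 -> R, forall j,
    {within T, continuous (g j)} /\
    forall x, T° x -> is_derive x (delta_mx j 0) f (g j x).

Definition A0 (R : realType) (a : 'I_3 -> 'cV[R]_2) (z : 'cV[R]_2) :
  set ('I_3 -> 'cV[R]_2 -> R) :=
  [set u | (forall i, is_poly 3 (u i)) /\
    exists f : 'cV[R]_2 -> R,
      (forall i x, CT a z i x -> f x = u i x) /\ C1_on (conv_hull a) f].

(* The subtriangles of index [k + 1] and [k + 2] share the edge [z, a k]. *)
Definition A1 (R : realType) (a : 'I_3 -> 'cV[R]_2) (z : 'cV[R]_2) :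
  set ('I_3 -> 'cV[R]_2 -> 'M[R]_2) :=
  [set u | [/\ forall i, is_polymx 1 (u i),
               forall i x, (u i x)^T = u i x &
               forall (k : 'I_3) (n : 'cV[R]_2) (t : R),
                 unit_normal n (a k - z) -> 0 <= t <= 1 ->
                 u (k + 1) (seg z (a k) t) *m n =
                 u (k + 2%:R) (seg z (a k) t) *m n]].

Definition A2 (R : realType) : set ('I_3 -> 'cV[R]_2 -> 'cV[R]_2) :=
  [set u | forall i, is_polymx 0 (u i)].

Definition airy (R : realType) (u : 'I_3 -> 'cV[R]_2 -> R) :
  'I_3 -> 'cV[R]_2 -> 'M[R]_2 :=
  fun k x => \matrix_(i, j)
    if i == 0 then
      if j == 0 then partial 1 (partial 1 (u k)) x
      else - partial 1 (partial 0 (u k)) x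
    else
      if j == 0 then - partial 0 (partial 1 (u k)) x
      else partial 0 (partial 0 (u k)) x.

Definition divergence (R : realType) (u : 'I_3 -> 'cV[R]_2 -> 'M[R]_2) :
  'I_3 -> 'cV[R]_2 -> 'cV[R]_2 :=
  fun k x => \col_i \sum_j partial j (fun y => u k y i j) x.

(* Integral over the triangle of a field given by pieces against [v]. *)
Definition pw_int (R : realType) (m n : nat) (a : 'I_3 -> 'cV[R]_2)
    (z : 'cV[R]_2) (u : 'I_3 -> 'cV[R]_2 -> 'M[R]_(m, n))
    (v : 'cV[R]_2 -> 'M[R]_(m, n)) : R :=
  \sum_k area_int (CT a z k) (fun x => dot (u k x) (v x)).

(* For fields in [A0] it does not matter which of the two pieces meeting at
   the vertex [a k] is used to evaluate the field and its gradient there. *)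
Definition dofs0 (R : realType) (a nu : 'I_3 -> 'cV[R]_2)
    (s : 'I_3 + 'I_3 * 'I_2 + 'I_3) (u : 'I_3 -> 'cV[R]_2 -> R) : R :=
  match s with
  | inl (inl k) => u (k + 1) (a k)
  | inl (inr (k, j)) => partial j (u (k + 1)) (a k)
  | inr i => edge_int a i (fun x => 'D_(nu i) (u i) x)
  end.

Definition dofs1 (R : realType) (a : 'I_3 -> 'cV[R]_2) (z : 'cV[R]_2)
    (nu : 'I_3 -> 'cV[R]_2) (vE : 'I_3 -> 'I_4 -> 'cV[R]_2 -> 'cV[R]_2)
    (vS : 'I_3 -> 'cV[R]_2 -> 'M[R]_2) (s : 'I_3 * 'I_4 + 'I_3)
    (u : 'I_3 -> 'cV[R]_2 -> 'M[R]_2) : R :=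
  match s with
  | inl (i, l) => edge_int a i (fun x => dot (u i x *m nu i) (vE i l x))
  | inr l => pw_int a z u (vS l)
  end.

Definition dofs2 (R : realType) (a : 'I_3 -> 'cV[R]_2) (z : 'cV[R]_2)
    (vT : 'I_6 -> 'cV[R]_2 -> 'cV[R]_2) (l : 'I_6)
    (u : 'I_3 -> 'cV[R]_2 -> 'cV[R]_2) : R :=
  pw_int a z u (vT l).

(* Main.v *)
Require Import Defs.
From HB Require Import structures.
From mathcomp Require Import all_boot all_order all_algebra.
From mathcomp Require Import all_classical all_reals all_analysis.
From mathcomp Require Import measurable_realfun ring lra.

(**
Seen from [z], the pieces of a field of [A0] are cubics whose differences have
vanishing gradient along the interior edges, and the pieces of a field of [A1]
are affine symmetric fields whose differences annihilate the normal of these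
edges.  Each space is thus the kernel of a linear map on coefficients, with
exactly as many equations as there are coefficients in excess of the DoFs; since
a square linear system is surjective as soon as it is injective, each
unisolvence statement reduces to showing that a field with vanishing DoFs is 0.

A field of [A1] with vanishing edge DoFs has zero normal component on the
boundary.  At a vertex of [T] the two adjacent pieces then vanish.  At [z] the
jumps of the three pieces are multiples of [s s^T], for [s] the three spokes;
they sum to 0, and the [s s^T] are independent, so the three values agree.  The
field is therefore a hat function times a constant matrix, and the interior DoFs
make this matrix 0.  For a field of [A0] with vanishing DoFs the gradient vanishes
on the boundary, so its Airy field has zero normal component there; being
divergence-free, it is 0 by the same analysis, and the field is affine, hence 0.

On each piece a divergence-free affine symmetric field has an explicit cubic
Airy potential, and normal continuity makes the potentials with zero 1-jet at
[z] agree to first order along the spokes.  The divergence is onto because each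
piece carries a field without normal component on its two spokes and with
prescribed divergence.

The integrals are evaluated by exact quadrature: Simpson's rule on edges, and on
triangles the vertex rule for affine functions, which follows from Fubini's
theorem by an affine change of variables to a symmetric reference triangle.
*)

Set Implicit Arguments.
Unset Strict Implicit.
Unset Printing Implicit Defensive.

Import Order.TTheory GRing.Theory Num.Theory.
Import numFieldNormedType.Exports.

Local Open Scope classical_set_scope.
Local Open Scope ring_scope.

(** * Affine substitutions in plane integrals *)

Section affine_change.
Context {R : realType}.
Local Notation mu := (@lebesgue_measure R).
Local Notation TR := (measurableTypeR R).

Lemma measurable_affine (k g : R) :
  measurable_fun [set: TR] (fun x : TR => k * x + g : TR).
Proof.
apply: continuous_measurable_fun => x.
by apply: cvgD; [apply: cvgM; [exact: cvg_cst|exact: cvg_id]|exact: cvg_cst].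
Qed.

(** The pushforward of Lebesgue measure, scaled by [|k|], gives half-open intervals their length, so
    it is Lebesgue measure by uniqueness. *)
Lemma lebesgue_measure_affine (k g : R) (A : set TR) : k != 0 -> measurable A ->
  mu A = (`|k|%:E * mu ((fun x : TR => (k * x + g)%R : TR) @^-1` A))%E.
Proof.
move=> k0 mA.
pose f := fun x : TR => (k * x + g)%R : TR.
have mf : measurable_fun setT f := measurable_affine k g.
pose pf : {measure set TR -> \bar R} :=
  measure_function_pushforward__canonical__measure_function_Measure mu mf.
pose nu : {measure set TR -> \bar R} := mscale (NngNum (normr_ge0 k)) pf.
suff : mu A = nu A by [].
apply: (@lebesgue_measure_unique R nu) => //= _ [[a b]] _ <-.
rewrite /nu /mscale/= /pushforward/=.
have [kp|kn] : 0 < k \/ k < 0 by case: (ltgtP k 0) k0 => //; auto.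
- have -> : f @^-1` `]a, b]%classic = `](a - g) / k, (b - g) / k]%classic.
    apply/seteqP; split => x /=; rewrite !in_itv/= /f ltr_pdivrMr// ler_pdivlMr//.
      by rewrite ltrBlDr lerBrDr mulrC.
    by rewrite ltrBlDr lerBrDr mulrC.
  rewrite !lebesgue_measure_itv/= !lte_fin ltr_pM2r ?invr_gt0// ltrD2r.
  case: ifP => _; last by rewrite mule0.
  rewrite -EFinM gtr0_norm//; congr (_%:E).
  by field; rewrite gt_eqF.
(* A negative slope moves the open end of the interval to the other side, which the measure does not
   see. *)
- have -> : f @^-1` `]a, b]%classic = `[(b - g) / k, (a - g) / k[%classic.
    apply/seteqP; split => x /=; rewrite !in_itv/= /f ltr_ndivlMr// ler_ndivrMr//.
      by rewrite ltrBlDr lerBrDr mulrC andbC.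
    by rewrite ltrBlDr lerBrDr mulrC andbC.
  rewrite !lebesgue_measure_itv/= !lte_fin ltr_nM2r ?invr_lt0// ltrD2r.
  case: ifP => _; last by rewrite mule0.
  rewrite -EFinM ltr0_norm//; congr (_%:E).
  by field; rewrite lt_eqF.
Qed.

Lemma ge0_integral_affine (k g : R) (f : TR -> \bar R) : k != 0 ->
  measurable_fun setT f -> (forall x, 0 <= f x)%E ->
  (\int[mu]_x f x = `|k|%:E * \int[mu]_x f (k * x + g)%R)%E.
Proof.
move=> k0 mf f0.
pose h := fun x : TR => (k * x + g)%R : TR.
have mh : measurable_fun setT h := measurable_affine k g.
pose pf : {measure set TR -> \bar R} :=
  measure_function_pushforward__canonical__measure_function_Measure mu mh.
pose nu : {measure set TR -> \bar R} := mscale (NngNum (normr_ge0 k)) pf.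
rewrite (eq_measure_integral nu); last first.
  by move=> A mA _; exact: lebesgue_measure_affine.
by rewrite /nu ge0_integral_mscale//= ge0_integral_pushforward.
Qed.

Local Notation mu2 := (mu \x mu)%E.

(* Substitutions that multiply integrals by a constant; they form a monoid
   that contains all affine bijections of the plane. *)
Definition scales_integral (s : TR * TR -> TR * TR) (k : R) :=
  measurable_fun setT s /\
  forall f : TR * TR -> \bar R, measurable_fun setT f -> (forall x, 0 <= f x)%E ->
  (\int[mu2]_x f x = k%:E * \int[mu2]_x f (s x))%E.

Lemma scales_integral_comp s t k l :
  scales_integral s k -> scales_integral t l -> scales_integral (s \o t) (k * l).
Proof.
move=> [ms hs] [mt ht]; split; first exact: measurableT_comp.
move=> f mf f0; rewrite hs// (ht (f \o s)); last 2 first.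
- exact: measurableT_comp.
- by move=> x /=.
by rewrite EFinM muleA.
Qed.

Lemma scales_integral_swap : scales_integral (fun x => (x.2, x.1)) 1.
Proof.
have ms : measurable_fun [set: TR * TR] (fun x : TR * TR => (x.2, x.1)).
  exact: measurable_fun_pair.
split=> // f mf f0; rewrite mul1e fubini_tonelli1//.
by rewrite (fubini_tonelli2 (fun x => f (x.2, x.1)))//; exact: measurableT_comp.
Qed.

(** By Tonelli this is the one-dimensional substitution on each line of constant second coordinate:
    the shift varies with the line, the factor does not. *)
Lemma scales_integral_fst (k l g : R) : k != 0 ->
  scales_integral (fun x => (k * x.1 + (l * x.2 + g), x.2)) `|k|.
Proof.
move=> k0.
have ms : measurable_fun [set: TR * TR]
    (fun x : TR * TR => (k * x.1 + (l * x.2 + g), x.2) : TR * TR).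
  apply: measurable_fun_pair => //; apply: measurable_funD => /=.
    apply: measurable_funM => //.
  by apply: measurable_funD => //; apply: measurable_funM.
split=> // f mf f0.
rewrite fubini_tonelli2// (fubini_tonelli2 (fun x => f (_, _)))//; last exact: measurableT_comp.
rewrite -ge0_integralZl//; last 2 first.
- by apply: measurable_fun_fubini_tonelli_G => //; exact: measurableT_comp.
- by move=> y _; apply: integral_ge0.
apply: eq_integral => y _; rewrite /fubini_G/=.
rewrite (ge0_integral_affine (l * y + g) k0)//.
exact: measurableT_comp.
Qed.

(** Gaussian elimination factors an affine bijection into swaps and maps that change only the first
    coordinate. The factor obtained is the absolute determinant, of which only the positivity is
    recorded. *)
Lemma scales_integral_affine (p : R * R) (u v : R * R) :
  u.1 * v.2 - u.2 * v.1 != 0 ->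
  exists2 k, 0 < k & scales_integral
    (fun x => (p.1 + x.1 * u.1 + x.2 * v.1, p.2 + x.1 * u.2 + x.2 * v.2)) k.
Proof.
(* If [u.1] is 0, the determinant forces [v.1] to be nonzero, and a swap exchanges the roles of [u]
   and [v]. *)
wlog u10 : u v / u.1 != 0 => [H D|D].
  have [u10|] := eqVneq u.1 0; last by move=> ?; exact: H.
  have v10 : v.1 != 0.
    by apply: contra_neq D => v10; rewrite u10 v10 mul0r mulr0 subrr.
  have D' : v.1 * u.2 - v.2 * u.1 != 0 by rewrite -oppr_eq0; apply: contra_neq D => <-; ring.
  have [k k0 hk] := H v u v10 D'.
  exists (k * 1); first by rewrite mulr1.
  have := scales_integral_comp hk scales_integral_swap.
  by congr (scales_integral _ _); apply/funext => x /=; congr (_, _); ring.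
have e0 : (u.1 * v.2 - u.2 * v.1) / u.1 != 0 by rewrite mulf_neq0// invr_neq0.
have := scales_integral_comp scales_integral_swap (scales_integral_comp
  (scales_integral_fst (u.2 / u.1) (p.2 - p.1 * u.2 / u.1) e0)
  (scales_integral_comp scales_integral_swap (scales_integral_fst v.1 p.1 u10))).
set k := (X in scales_integral _ X) => hk; exists k.
  by rewrite /k !mulr_gt0// ?normr_gt0.
move: hk; congr (scales_integral _ _); apply/funext => x /=; congr (_, _); field => //.
Qed.

End affine_change.

(** * Barycentric coordinates *)

Section plane.
Context {R : realType}.
Implicit Types (u v x y : 'cV[R]_2) (b : 'I_3 -> 'cV[R]_2).

Lemma ord3_ind (P : 'I_3 -> Prop) : P 0 -> P 1 -> P 2%:R -> forall i, P i.
Proof.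
move=> P0 P1 P2 [[|[|[|//]]] i].
- by rewrite (_ : Ordinal i = 0)//; exact/val_inj.
- by rewrite (_ : Ordinal i = 1)//; exact/val_inj.
- by rewrite (_ : Ordinal i = 2%:R)//; exact/val_inj.
Qed.

Lemma ord3D : (((0 + 1)%R = 1 :> 'I_3) * ((1 + 1)%R = 2%:R :> 'I_3) *
  ((2%:R + 1)%R = 0 :> 'I_3) * ((0 + 2%:R)%R = 2%:R :> 'I_3) * ((1 + 2%:R)%R = 0 :> 'I_3) *
  ((2%:R + 2%:R)%R = 1 :> 'I_3))%type.
Proof. by do !split; exact/val_inj. Qed.

Lemma sum3 (V : nmodType) (F : 'I_3 -> V) : \sum_i F i = F 0 + F 1 + F 2%:R.
Proof.
rewrite !big_ord_recl big_ord0 addr0 addrA.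
by congr (_ + F _ + F _); exact/val_inj.
Qed.

Lemma sum2 (V : nmodType) (F : 'I_2 -> V) : \sum_i F i = F 0 + F 1.
Proof. by rewrite !big_ord_recl big_ord0 addr0; congr (_ + F _); exact/val_inj. Qed.

Lemma ord2_ind (P : 'I_2 -> Prop) : P 0 -> P 1 -> forall i, P i.
Proof.
move=> P0 P1 [[|[|//]] i].
- by rewrite (_ : Ordinal i = 0)//; exact/val_inj.
- by rewrite (_ : Ordinal i = 1)//; exact/val_inj.
Qed.

Lemma cV2P u v : u 0 0 = v 0 0 -> u 1 0 = v 1 0 -> u = v.
Proof. by move=> h0 h1; apply/matrixP => i j; rewrite ord1; elim/ord2_ind : i. Qed.

Definition cr u v : R := u 0 0 * v 1 0 - u 1 0 * v 0 0.

Lemma free_cr u v : free [:: u; v] -> cr u v != 0.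
Proof.
rewrite free_cons seq1_free => /andP[uv v0]; apply: contra uv => /eqP uv.
rewrite span_seq1; apply/vlineP; move: uv; rewrite /cr.
have [v00|v00] := eqVneq (v 0 0) 0; last first.
  exists (u 0 0 / v 0 0); apply: cV2P; rewrite !mxE ?divfK//.
  by rewrite mulrAC; apply: (canRL (mulfK v00)); apply/eqP; rewrite eq_sym -subr_eq0 uv.
have v10 : v 1 0 != 0.
  by apply: contra v0 => /eqP v10; apply/eqP/cV2P; rewrite mxE.
exists (u 1 0 / v 1 0); apply: cV2P; rewrite !mxE ?divfK//.
rewrite v00 mulr0; move/eqP: uv; rewrite v00 mulr0 subr0 mulf_eq0 (negbTE v10) orbF.
by move=> /eqP.
Qed.

Definition area2 b := cr (b 1 - b 0) (b 2%:R - b 0).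

(** A quotient of signed areas: the numerator is the signed area of the triangle with [b j] replaced
    by [x], up to the same factor 2 as in [area2]. *)
Definition bary b j x := cr (b (j + 1) - x) (b (j + 2%:R) - x) / area2 b.

Lemma sum_bary b x : area2 b != 0 -> \sum_j bary b j x = 1.
Proof.
rewrite sum3 /bary !ord3D /area2 /cr !mxE => b0; field.
by apply: contra b0 => /eqP b0; rewrite -b0; apply/eqP; ring.
Qed.

Lemma sum_bary_scale b x : area2 b != 0 -> \sum_j bary b j x *: b j = x.
Proof.
rewrite sum3 /bary !ord3D /area2 /cr => b0.
apply: cV2P; move: b0; rewrite !mxE => b0; field.
- by apply: contra b0 => /eqP b0; rewrite -b0; apply/eqP; ring.
- by apply: contra b0 => /eqP b0; rewrite -b0; apply/eqP; ring.
Qed.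

Lemma bary_conv b (c : 'I_3 -> R) j : area2 b != 0 -> \sum_i c i = 1 ->
  bary b j (\sum_i c i *: b i) = c j.
Proof.
move=> b0; rewrite sum3 => c1.
have c0E : c 0 = 1 - c 1 - c 2%:R by rewrite -c1; ring.
apply: (mulIf b0); rewrite divfK// sum3 /area2 /cr; elim/ord3_ind : j;
  by rewrite !ord3D !mxE c0E; ring.
Qed.

Lemma bary_vertex b l j : area2 b != 0 -> bary b l (b j) = (l == j)%:R.
Proof.
move=> b0; transitivity (bary b l (\sum_k (k == j)%:R *: b k)).
  by rewrite (bigD1 j)//= eqxx scale1r big1 ?addr0// => k /negbTE ->; rewrite scale0r.
rewrite (bary_conv (c := fun k => (k == j)%:R))//.
by rewrite (bigD1 j)//= eqxx big1 ?addr0// => k /negbTE ->.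
Qed.

Lemma conv_hullE b : area2 b != 0 ->
  conv_hull b = [set x | forall j, 0 <= bary b j x].
Proof.
move=> b0; apply/seteqP; split => [x [c [c0 c1 ->]] j|x h].
  by rewrite bary_conv.
exists (bary b ^~ x); split => //; first exact: sum_bary.
by rewrite sum_bary_scale.
Qed.

End plane.

(** * Cubic polynomials *)

Section cubics.
Context {R : realType}.
Implicit Types (x y z v : 'cV[R]_2).

(** [kij] is the coefficient of X^i Y^j. Named coefficients turn statements on cubics into
    identities between reals, within reach of [ring] and [field]. *)
Record cubic := Cubic { k00 : R; k10 : R; k01 : R; k20 : R; k11 : R; k02 : R;
  k30 : R; k21 : R; k12 : R; k03 : R }.

Definition cub k y :=
  let X := y 0 0 in let Y := y 1 0 in
  k00 k + k10 k * X + k01 k * Y + k20 k * X ^+ 2 + k11 k * X * Y + k02 k * Y ^+ 2 +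
  k30 k * X ^+ 3 + k21 k * X ^+ 2 * Y + k12 k * X * Y ^+ 2 + k03 k * Y ^+ 3.

Definition dcub (j : 'I_2) k := if j == 0 then
    Cubic (k10 k) (2 * k20 k) (k11 k) (3 * k30 k) (2 * k21 k) (k12 k) 0 0 0 0
  else Cubic (k01 k) (k11 k) (2 * k02 k) (k21 k) (2 * k12 k) (3 * k03 k) 0 0 0 0.

(** The difference quotient equals A + h B + h^2 C exactly, and this tends to A. *)
Lemma is_derive_expansion (f : 'cV[R]_2 -> R) x v (A B C : R) :
  (forall h, f (h *: v + x) = f x + h * A + h ^+ 2 * B + h ^+ 3 * C) ->
  is_derive x v f A.
Proof.
move=> fE.
have cv : h^-1 *: ((f \o shift x) (h *: v) - f x) @[h --> 0^'] --> A.
  have : A + h * B + h ^+ 2 * C @[h --> 0^'] --> A + 0 * B + 0 ^+ 2 * C.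
    apply: cvg_within_filter; apply: cvgD; last first.
      by apply: cvgM; [exact: exprn_continuous|exact: cvg_cst].
    by apply: cvgD; [exact: cvg_cst|apply: cvgM; [exact: cvg_id|exact: cvg_cst]].
  rewrite mul0r expr0n/= mul0r !addr0; apply: cvg_trans; apply: near_eq_cvg.
  near=> h; have h0 : h != 0 by near: h; exact: nbhs_dnbhs_neq.
  rewrite /= fE /GRing.scale/=; field => //.
apply: DeriveDef; first by apply/cvg_ex; exists A.
exact: cvg_lim.
Unshelve. all: by end_near. Qed.

Lemma is_derive_cub k z x v : is_derive x v (fun x => cub k (x - z))
  (v 0 0 * cub (dcub 0 k) (x - z) + v 1 0 * cub (dcub 1 k) (x - z)).
Proof.
pose X := (x - z) 0 0; pose Y := (x - z) 1 0.
apply: (@is_derive_expansion _ _ _ _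
  (k20 k * v 0 0 ^+ 2 + k11 k * v 0 0 * v 1 0 + k02 k * v 1 0 ^+ 2
   + 3 * k30 k * X * v 0 0 ^+ 2 + k21 k * (2 * X * v 0 0 * v 1 0 + Y * v 0 0 ^+ 2)
   + k12 k * (2 * Y * v 0 0 * v 1 0 + X * v 1 0 ^+ 2) + 3 * k03 k * Y * v 1 0 ^+ 2)
  (k30 k * v 0 0 ^+ 3 + k21 k * v 0 0 ^+ 2 * v 1 0 + k12 k * v 0 0 * v 1 0 ^+ 2
   + k03 k * v 1 0 ^+ 3)) => h.
have e0 : (h *: v + x - z) 0 0 = h * v 0 0 + X by rewrite /X !mxE addrA.
have e1 : (h *: v + x - z) 1 0 = h * v 1 0 + Y by rewrite /Y !mxE addrA.
by rewrite /cub /dcub/= e0 e1 -/X -/Y; ring.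
Qed.

Lemma derive_cub k z x v : 'D_v (fun x => cub k (x - z)) x =
  v 0 0 * cub (dcub 0 k) (x - z) + v 1 0 * cub (dcub 1 k) (x - z).
Proof. by case: (is_derive_cub k z x v). Qed.

Lemma partial_cub j k z : partial j (fun x => cub k (x - z)) =
  fun x => cub (dcub j k) (x - z).
Proof.
apply/funext => x; rewrite /partial derive_cub.
by elim/ord2_ind : j; rewrite !mxE/= ?mul1r ?mul0r ?addr0 ?add0r.
Qed.

Definition affine (p : R * R * R) y := p.1.1 + p.1.2 * y 0 0 + p.2 * y 1 0.

Lemma affine_cub p : affine p = cub (Cubic p.1.1 p.1.2 p.2 0 0 0 0 0 0 0).
Proof. by apply/funext => y; rewrite /affine /cub/=; ring. Qed.


(** These are the Taylor coefficients of [k] at [v]. *)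
Definition shift_cub k v :=
  let X := v 0 0 in let Y := v 1 0 in
  Cubic (cub k v) (cub (dcub 0 k) v) (cub (dcub 1 k) v)
    (k20 k + 3 * k30 k * X + k21 k * Y) (k11 k + 2 * k21 k * X + 2 * k12 k * Y)
    (k02 k + 3 * k03 k * Y + k12 k * X) (k30 k) (k21 k) (k12 k) (k03 k).

Lemma cub_shift k v y : cub k (y + v) = cub (shift_cub k v) y.
Proof. by rewrite /cub /shift_cub /= /cub /dcub/= !mxE; ring. Qed.

Lemma sum_le3 (F : nat -> nat -> R) :
  \sum_(i < 4) \sum_(j < 4 | (i + j <= 3)%N) F i j = F 0%N 0%N + F 1%N 0%N + F 0%N 1%N +
  F 2%N 0%N + F 1%N 1%N + F 0%N 2%N + F 3%N 0%N + F 2%N 1%N + F 1%N 2%N + F 0%N 3%N.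
Proof.
under eq_bigr do rewrite big_mkcond !big_ord_recl big_ord0 /=.
by rewrite !big_ord_recl big_ord0 /= /bump/=; ring.
Qed.

(** Centring at [z] puts the interior vertex at the origin, where the interior edges become segments
    [t *: s]. *)
Lemma is_poly3P z f : is_poly 3 f <-> exists k, f = fun x => cub k (x - z).
Proof.
suff H : is_poly 3 f <-> exists k, f = cub k.
  rewrite H; split => -[k ->].
    exists (shift_cub k z); apply/funext => x.
    by rewrite -cub_shift subrK.
  by exists (shift_cub k (- z)); apply/funext => x; rewrite -cub_shift.
split => [[c fE]|[k ->]].
  exists (Cubic (c 0%N 0%N) (c 1%N 0%N) (c 0%N 1%N) (c 2%N 0%N) (c 1%N 1%N)
    (c 0%N 2%N) (c 3%N 0%N) (c 2%N 1%N) (c 1%N 2%N) (c 0%N 3%N)).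
  apply/funext => x.
  by rewrite fE (sum_le3 (fun i j => c i j * x 0 0 ^+ i * x 1 0 ^+ j)) /cub/=; ring.
pose c i j := (match i, j with 0, 0 => k00 k | 1, 0 => k10 k | 0, 1 => k01 k
  | 2, 0 => k20 k | 1, 1 => k11 k | 0, 2 => k02 k | 3, 0 => k30 k | 2, 1 => k21 k
  | 1, 2 => k12 k | _, _ => k03 k end%N).
by exists c => x; rewrite (sum_le3 (fun i j => c i j * x 0 0 ^+ i * x 1 0 ^+ j)) /cub/=; ring.
Qed.

Lemma is_poly1P z f : is_poly 1 f <-> exists p, f = fun x => affine p (x - z).
Proof.
have sum_le1 (F : nat -> nat -> R) : \sum_(i < 2) \sum_(j < 2 | (i + j <= 1)%N) F i j =
    F 0%N 0%N + F 1%N 0%N + F 0%N 1%N.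
  under eq_bigr do rewrite big_mkcond !big_ord_recl big_ord0 /=.
  by rewrite !big_ord_recl big_ord0 /= /bump/=; ring.
split => [[c fE]|[[[p q] r] ->]].
  exists (c 0%N 0%N + c 1%N 0%N * z 0 0 + c 0%N 1%N * z 1 0, c 1%N 0%N, c 0%N 1%N).
  apply/funext => x.
  by rewrite fE (sum_le1 (fun i j => c i j * x 0 0 ^+ i * x 1 0 ^+ j)) /affine/= !mxE; ring.
pose s := p - q * z 0 0 - r * z 1 0.
pose c i j := (match i, j with 0, 0 => s
  | 1, 0 => q | _, _ => r end%N).
exists c => x; rewrite (sum_le1 (fun i j => c i j * x 0 0 ^+ i * x 1 0 ^+ j)).
by rewrite /affine/= !mxE /s; ring.
Qed.

Lemma is_poly0P (f : 'cV[R]_2 -> R) : is_poly 0 f <-> exists c, f = cst c.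
Proof.
have sum_le0 (F : nat -> nat -> R) : \sum_(i < 1) \sum_(j < 1 | (i + j <= 0)%N) F i j =
    F 0%N 0%N.
  under eq_bigr do rewrite big_mkcond !big_ord_recl big_ord0 /=.
  by rewrite !big_ord_recl big_ord0 /= /bump/=; ring.
split => [[c fE]|[c ->]].
  exists (c 0%N 0%N); apply/funext => x.
  by rewrite fE (sum_le0 (fun i j => c i j * x 0 0 ^+ i * x 1 0 ^+ j))/=; ring.
exists (fun i j => c) => x.
by rewrite (sum_le0 (fun i j => c * x 0 0 ^+ i * x 1 0 ^+ j)) /=; ring.
Qed.

Lemma is_poly1_interp (b : 'I_3 -> 'cV[R]_2) f x : area2 b != 0 -> is_poly 1 f ->
  f x = \sum_j bary b j x * f (b j).
Proof.
move=> b0 /(is_poly1P 0)[[[k l] m] ->]; rewrite /affine/=.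
have /(congr1 (fun u : 'cV[R]_2 => u 0 0)) := sum_bary_scale x b0.
have /(congr1 (fun u : 'cV[R]_2 => u 1 0)) := sum_bary_scale x b0.
have := sum_bary x b0; rewrite !sum3 !mxE => e1 e2 e3.
rewrite -{1}e2 -{1}e3 -[k in LHS]mulr1 -{1}e1; ring.
Qed.

End cubics.

(** * Quadrature *)

Section triangle_integral.
Context {R : realType}.
Local Notation TR := (measurableTypeR R).
Local Notation mu2 := ((@lebesgue_measure R) \x (@lebesgue_measure R))%E.
Variable b : 'I_3 -> 'cV[R]_2.
Hypothesis b0 : area2 b != 0.

Let r j (x : TR * TR) := bary b j (pt x).
Let D : set (TR * TR) := @pt R @^-1` conv_hull b.
Let F j : TR * TR -> \bar R := (EFin \o r j) \_ D.

Let DE : D = [set x | 0 <= r 0 x] `&` [set x | 0 <= r 1 x] `&` [set x | 0 <= r 2%:R x].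
Proof.
rewrite /D conv_hullE//; apply/seteqP; split => x /=.
  by move=> h; do !split; exact: h.
by move=> [[h0 h1] h2]; exact: ord3_ind.
Qed.

Let mr j : measurable_fun [set: TR * TR] (r j).
Proof.
rewrite /r /bary /cr; apply: measurable_funM => //.
have m i k : measurable_fun [set: TR * TR]
    (fun x : TR * TR => (b i - pt x) k 0).
  elim/ord2_ind : k.
  - under eq_fun do rewrite !mxE/=.
    by apply: measurable_funB.
  - under eq_fun do rewrite !mxE/=.
    by apply: measurable_funB.
by apply: measurable_funB; apply: measurable_funM.
Qed.

Let mD : measurable D.
Proof.
rewrite DE.
have m j : measurable [set x | 0 <= r j x].
  rewrite [X in measurable X](_ : _ = r j @^-1` `[0, +oo[%classic).
    by rewrite -[X in measurable X]setTI; exact: mr.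
  by apply/seteqP; split => x /=; rewrite in_itv/= andbT.
by apply: measurableI => //; apply: measurableI.
Qed.

Let mF j : measurable_fun setT (F j).
Proof.
apply/(measurable_restrictT _ mD)/measurable_EFinP.
exact: measurable_funS (mr j).
Qed.

Let F0 j x : (0 <= F j x)%E.
Proof.
rewrite /F patchE; case: ifPn => // /set_mem.
by rewrite /D conv_hullE//= lee_fin; exact.
Qed.

(** The affine map that sends (0,0), (1,0), (0,1) to the vertices of [b]; it pulls the barycentric
    coordinates back to 1 - x - y, x and y. *)
Let p (x : TR * TR) : TR * TR :=
  ((b 0) 0 0 + x.1 * (b 1 - b 0) 0 0 + x.2 * (b 2%:R - b 0) 0 0,
   (b 0) 1 0 + x.1 * (b 1 - b 0) 1 0 + x.2 * (b 2%:R - b 0) 1 0).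

Let rp j x : r j (p x) =
  if j == 0 then 1 - x.1 - x.2 else if j == 1 then x.1 else x.2.
Proof.
pose c (i : 'I_3) := if i == 0 then 1 - x.1 - x.2 else if i == 1 then x.1 else x.2.
rewrite -/(c j) /r (_ : pt (p x) = \sum_i c i *: b i).
  by rewrite bary_conv// sum3 /c/=; ring.
by rewrite sum3 /c/= /p; apply: cV2P; rewrite !mxE/=; ring.
Qed.

Let Fp j x : F j (p x) = if [&& x.1 + x.2 <= 1, 0 <= x.1 & 0 <= x.2] then
  (if j == 0 then 1 - x.1 - x.2 else if j == 1 then x.1 else x.2)%:E else 0%E.
Proof.
rewrite /F patchE/= rp (_ : (p x \in D) = [&& x.1 + x.2 <= 1, 0 <= x.1 & 0 <= x.2])//.
rewrite DE; apply/idP/idP.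
  rewrite inE/= !rp/= => -[[h0 h1] h2]; apply/and3P; split => //.
  by rewrite -subr_ge0 opprD addrA.
move=> /and3P[h0 h1 h2]; rewrite inE/= !rp/=; split=> //; split=> //.
by rewrite -addrA -opprD subr_ge0.
Qed.

(** The symmetries of the reference triangle equate the three integrals: the swap exchanges
    coordinates 1 and 2, and (x,y) -> (1-x-y,y) exchanges 0 and 1. The common value is not computed,
    only bounded away from 0 and infinity. *)
Let I : exists2 I : R, 0 < I & forall j, (\int[mu2]_x F j (p x) = I%:E)%E.
Proof.
have D0 : (b 1 - b 0) 0 0 * (b 2%:R - b 0) 1 0 - (b 1 - b 0) 1 0 * (b 2%:R - b 0) 0 0 != 0.
  by [].
have [k k0 [mp _]] := @scales_integral_affine R ((b 0) 0 0, (b 0) 1 0)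
  ((b 1 - b 0) 0 0, (b 1 - b 0) 1 0) ((b 2%:R - b 0) 0 0, (b 2%:R - b 0) 1 0) D0.
have mFp j : measurable_fun [set: TR * TR] (F j \o p) by exact: measurableT_comp.
have mFB (B : set (TR * TR)) j : measurable_fun B (fun x => F j (p x)).
  exact: (measurable_funS measurableT (@subsetT _ B) (mFp j)).
have F0p j x : (0 <= (F j \o p) x)%E by exact: F0.
have F21 : (\int[mu2]_x F 2%:R (p x) = \int[mu2]_x F 1 (p x))%E.
  have [_ /(_ (F 2%:R \o p) (mFp _) (F0p _))/= ->] := @scales_integral_swap R.
  rewrite mul1e; apply: eq_integral => x _; rewrite !Fp/= andbA andbAC -andbA.
  by rewrite [x.2 + _]addrC.
have F10 : (\int[mu2]_x F 1 (p x) = \int[mu2]_x F 0 (p x))%E.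
  have m10 : -1 != 0 :> R by rewrite oppr_eq0 oner_eq0.
  have [_ /(_ (F 1 \o p) (mFp _) (F0p _))/= ->] := scales_integral_fst (-1) 1 m10.
  rewrite normrN1 mul1e; apply: eq_integral => x _; rewrite !Fp/=.
  have e : -1 * x.1 + (-1 * x.2 + 1) = 1 - x.1 - x.2 by ring.
  rewrite e; congr (if _ then _ else _).
  by apply/idP/idP => /and3P[h0 h1 h2]; apply/and3P; split; lra.
(* The square [1/4,1/2]^2 lies in the reference triangle, has area 1/16, and the integrand is at
   least 1/4 on it. *)
have Fge : ((4^-1 * 16^-1)%:E <= \int[mu2]_x F 1 (p x))%E.
  pose B : set (TR * TR) := `[4^-1, 2^-1 : R]%classic `*` `[4^-1, 2^-1 : R]%classic.
  have mB : measurable (B : set (TR * TR)) by apply: measurableX.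
  apply: (@le_trans _ _ (\int[mu2]_(x in B) F 1 (p x))%E); last first.
    by apply: ge0_subset_integral => //=; exact: (mFp 1).
  apply: (@le_trans _ _ (\int[mu2]_(x in B) (4^-1)%:E)%E); last first.
    apply: ge0_le_integral => //=.
    move=> x [/=]; rewrite !in_itv/= => /andP[h1 h2] /andP[h3 h4].
      by rewrite Fp/= ifT ?lee_fin//; apply/and3P; split; lra.
  rewrite integral_cst//= product_measure1E//= !lebesgue_measure_itv/=.
  have lt42 : ((4^-1 : R)%:E < (2^-1 : R)%:E)%E by rewrite lte_fin; lra.
  by rewrite !lt42 -!EFinB -!EFinM lee_fin; lra.
(* The integrand is at most 1 and vanishes outside the unit square. *)
have Fle : (\int[mu2]_x F 1 (p x) <= 1)%E.
  pose B : set (TR * TR) := `[0, 1 : R]%classic `*` `[0, 1 : R]%classic.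
  have mB : measurable (B : set (TR * TR)) by apply: measurableX.
  apply: (@le_trans _ _ (\int[mu2]_(x in B) F 1 (p x))%E).
    rewrite [leRHS]integral_mkcond; apply: ge0_le_integral => //=.
    + by apply/(measurable_restrictT _ mB); exact: mFB.
    + move=> x _; rewrite patchE; case: ifPn => // xB.
      rewrite Fp; case: ifPn => // /and3P[h0 h1 h2]; move: xB.
      rewrite notin_setE/=; case; split; rewrite /= in_itv/=; apply/andP; split => //; lra.
  apply: (@le_trans _ _ (\int[mu2]_(x in B) 1)%E).
    apply: ge0_le_integral => //=.
    move=> x [/=]; rewrite !in_itv/= => /andP[h1 h2] /andP[h3 h4].
      by rewrite Fp/=; case: ifP => //; rewrite lee_fin.
  rewrite integral_cst//= product_measure1E//= !lebesgue_measure_itv/=.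
  by rewrite !lte_fin ltr01 !oppr0 -!EFinD !addr0 !mul1e.
exists (fine (\int[mu2]_x F 1 (p x))%E).
  apply: fine_gt0; apply/andP; split; last exact: le_lt_trans Fle (ltry _).
  by apply: lt_le_trans Fge; rewrite lte_fin; lra.
have Ffin : (\int[mu2]_x F 1 (p x))%E \is a fin_num.
  by rewrite ge0_fin_numE ?integral_ge0//; exact: le_lt_trans Fle (ltry _).
elim/ord3_ind.
- by rewrite -F10 fineK.
- by rewrite fineK.
- by rewrite F21 fineK.
Qed.

(** An affine function is the combination of the barycentric coordinates weighted by its vertex
    values, and these coordinates share one integral, [w]. The integrand [f] only has to agree with
    [g] on the triangle because test functions are cut off outside it. *)
Lemma area_int_affine : exists2 w, 0 < w &
  forall f g : 'cV[R]_2 -> R, is_poly 1 g -> (forall x, conv_hull b x -> f x = g x) ->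
  area_int (conv_hull b) f = w * \sum_j g (b j).
Proof.
have [I0 I0pos FI] := I.
have D0 : (b 1 - b 0) 0 0 * (b 2%:R - b 0) 1 0 - (b 1 - b 0) 1 0 * (b 2%:R - b 0) 0 0 != 0.
  by [].
have [c c0 [mp hp]] := @scales_integral_affine R ((b 0) 0 0, (b 0) 1 0)
  ((b 1 - b 0) 0 0, (b 1 - b 0) 1 0) ((b 2%:R - b 0) 0 0, (b 2%:R - b 0) 1 0) D0.
have intr j : (\int[mu2]_(x in D) (r j x)%:E = (c * I0)%:E)%E.
  rewrite integral_mkcond EFinM -(FI j).
  by apply: (hp (F j)); [exact: mF|exact: F0].
have ir j : mu2.-integrable D (EFin \o r j).
  apply/integrableP; split.
    by apply/measurable_EFinP; exact: (measurable_funS measurableT (@subsetT _ D) (mr j)).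
  rewrite (eq_integral (EFin \o r j)) ?intr ?ltry// => x /set_mem.
  by rewrite /D conv_hullE//= => /(_ j) xD; rewrite ger0_norm.
exists (c * I0) => [|f g gp fg]; first exact: mulr_gt0.
have Rr j : \int[mu2]_(x in D) r j x = c * I0 by rewrite /Rintegral intr.
have fE x : x \in D -> f (pt x) = g (b 0) * r 0 x + g (b 1) * r 1 x + g (b 2%:R) * r 2%:R x.
  by move=> /set_mem xD; rewrite fg// (is_poly1_interp _ b0 gp) sum3 /r; ring.
have iZ t j : mu2.-integrable D (fun x => (t * r j x)%:E).
  exact: (integrableZl mD t (ir j)).
have RZ t j : \int[mu2]_(x in D) (t * r j x) = t * (c * I0).
  by rewrite RintegralZl// Rr.
transitivity (\int[mu2]_(x in D) (g (b 0) * r 0 x + g (b 1) * r 1 x + g (b 2%:R) * r 2%:R x)).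
  exact: (eq_Rintegral _ fE).
have iD : mu2.-integrable D (fun x => (g (b 0) * r 0 x + g (b 1) * r 1 x)%:E).
  exact: (integrableD mD (iZ _ _) (iZ _ _)).
rewrite (RintegralD mD iD (iZ _ _)) (RintegralD mD (iZ _ _) (iZ _ _)).
by rewrite !RZ sum3; ring.
Qed.

End triangle_integral.

(** * Simpson's rule on edges *)

Section simpson.
Context {R : realType}.

Lemma Rintegral_quadratic (p q r : R) :
  \int[lebesgue_measure]_(t in `[0, 1]) (p + q * t + r * t ^+ 2) = p + q / 2 + r / 3 :> R.
Proof.
pose F (t : R) : R := p * t + q / 2 * t ^+ 2 + r / 3 * t ^+ 3.
have dF (x : R) : is_derive x 1 F (p + q * x + r * x ^+ 2).
  by rewrite /F; apply: is_derive_eq; rewrite /GRing.scale/=; field.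
rewrite /Rintegral (@continuous_FTC2 _ _ F)//=.
- by rewrite /F; field.
- apply: continuous_subspaceT => x; apply: cvgD; last first.
    by apply: cvgM; [exact: cvg_cst|exact: exprn_continuous].
  by apply: cvgD; [exact: cvg_cst|apply: cvgM; [exact: cvg_cst|exact: cvg_id]].
- have cF x : F y @[y --> x] --> F x.
    by apply: differentiable_continuous; apply/derivable1_diffP; case: (dF x).
  split=> [x _||]; first by case: (dF x).
  + by apply: cvg_at_right_filter; exact: cF.
  + by apply: cvg_at_left_filter; exact: cF.
- by move=> x _; rewrite derive1E; case: (dF x).
Qed.

(** Simpson's rule is exact on quadratics. As on triangles, [f] is compared with the polynomial [g]
    on the edge only. *)
Lemma edge_int_quadratic (a : 'I_3 -> 'cV[R]_2) i (f g : 'cV[R]_2 -> R) :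
  (exists p q r, forall t, g (edge_pt a i t) = p + q * t + r * t ^+ 2) ->
  (forall t, 0 <= t <= 1 -> f (edge_pt a i t) = g (edge_pt a i t)) ->
  edge_int a i f = Num.sqrt (dot (edge_vec a i) (edge_vec a i)) *
    ((g (edge_pt a i 0) + 4 * g (edge_pt a i 2^-1) + g (edge_pt a i 1)) / 6).
Proof.
move=> [p [q [r gE]]] fg; congr (_ * _).
transitivity (\int[lebesgue_measure]_(t in `[0, 1]) (p + q * t + r * t ^+ 2)).
  by apply: eq_Rintegral => t; rewrite inE/= in_itv/= => /fg ->.
by rewrite Rintegral_quadratic !gE; field.
Qed.

End simpson.

(** * Unisolvence by a dimension count *)

Section linear_algebra.
Context {R : realType}.

Lemma lin_sum (E F : lmodType R) (L : E -> F) (I : Type) (s : seq I) (c : I -> R) (e : I -> E) :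
  (forall k u v, L (k *: u + v) = k *: L u + L v) ->
  L (\sum_(i <- s) c i *: e i) = \sum_(i <- s) c i *: L (e i).
Proof.
move=> hL; elim: s => [|i s IH]; last by rewrite !big_cons hL IH.
(* Linearity with k = -1 and both vectors 0 gives L 0 = 0. *)
by rewrite !big_nil; have := hL (-1) 0 0; rewrite !scaleN1r oppr0 addr0 addNr.
Qed.

(** The matrix of [L] in the canonical bases is square; injectivity makes it row free, so its rank
    is full and it is row full as well. *)
Lemma lin_inj_surj (I J : finType) (L : {ffun I -> R} -> {ffun J -> R}) :
  #|I| = #|J| -> (forall k u v, L (k *: u + v) = k *: L u + L v) ->
  (forall u, L u = 0 -> u = 0) -> forall w, exists u, L u = w.
Proof.
move=> IJ hL L0 w.
pose d (i : I) : {ffun I -> R} := [ffun j => (i == j)%:R].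
have dE (c : {ffun I -> R}) : c = \sum_i c i *: d i.
  apply/ffunP => j; rewrite sum_ffunE (bigD1 j)//= big1 ?addr0.
    by rewrite !ffunE eqxx; apply/esym/mulr1.
  by move=> i /negbTE ij; rewrite !ffunE ij; exact: mulr0.
pose M : 'M[R]_(#|I|, #|J|) := \matrix_(i, j) L (d (enum_val i)) (enum_val j).
pose f (v : 'rV[R]_#|I|) : {ffun I -> R} := [ffun i => v 0 (enum_rank i)].
have LM v j : L (f v) (enum_val j) = (v *m M) 0 j.
  rewrite (dE (f v)) lin_sum// sum_ffunE !mxE (reindex (fun i : 'I_#|I| => enum_val i))/=; last first.
    by exists enum_rank => i _; rewrite ?enum_valK ?enum_rankK.
  by apply: eq_bigr => i _; rewrite !ffunE enum_valK mxE.
have Mfree : row_free M.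
  apply/inj_row_free => v vM; have fv0 : f v = 0.
    apply: L0; apply/ffunP => j; rewrite -(enum_rankK j) LM vM !mxE.
    by rewrite ffunE.
  apply/rowP => i; have := congr1 (fun c : {ffun I -> R} => c (enum_val i)) fv0.
  by rewrite !ffunE enum_valK mxE.
have Mfull : row_full M by move: Mfree; rewrite /row_free /row_full => /eqP ->; exact/eqP.
have /submxP[v vM] := submx_full (\row_j w (enum_val j)) Mfull.
exists (f v); apply/ffunP => j; rewrite -(enum_rankK j) LM -vM mxE.
by rewrite enum_rankK.
Qed.

Lemma is_basis_reindex (E : lmodType R) (I J : finType) (A : set E) (b : J -> E)
    (f : I -> J) (g : J -> I) : cancel f g -> cancel g f ->
  is_basis A b -> is_basis A (b \o f).
Proof.
move=> fg gf [bA bu]; split => [i|u /bu [c [uc cu]]]; first exact: bA.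
exists [ffun i => c (f i)]; split => [|c' uc'].
  rewrite uc (reindex f)/=; last by exists g => x _.
  by apply: eq_bigr => i _; rewrite ffunE.
apply/ffunP => i; rewrite ffunE (cu [ffun j => c' (g j)]) ?ffunE ?fg//.
rewrite uc' (reindex g)/=; last by exists f => x _.
by apply: eq_bigr => j _; rewrite ffunE gf.
Qed.

(* [A] is the image under [phi] of the kernel of [kappa]; as [(kappa, l \o phi)]
   is a square linear system, the injectivity of the forms [l] on [A] entails
   that they can be prescribed. *)
Lemma unisolvent_of_injective (E : lmodType R) (A : set E) (I J K : finType)
    (phi : {ffun I -> R} -> E) (kappa : {ffun I -> R} -> {ffun J -> R})
    (l : K -> E -> R) (n : nat) :
  #|K| = n -> #|I| = (#|J| + n)%N ->
  (forall k u v, phi (k *: u + v) = k *: phi u + phi v) ->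
  (forall k u v, kappa (k *: u + v) = k *: kappa u + kappa v) ->
  (forall i k u v, l i (phi (k *: u + v)) = k * l i (phi u) + l i (phi v)) ->
  (forall c, kappa c = 0 -> A (phi c)) ->
  (forall u, A u -> exists2 c, kappa c = 0 & phi c = u) ->
  (forall c, kappa c = 0 -> phi c = 0 -> c = 0) ->
  (forall u, A u -> (forall i, l i u = 0) -> u = 0) ->
  has_dim A n /\ unisolvent A l.
Proof.
move=> <- IJK hphi hkap hl kapA Akap phi0 l0.
have Alin k u v : A u -> A v -> A (k *: u + v).
  move=> /Akap[c c0 <-] /Akap[c' c'0 <-]; rewrite -hphi; apply: kapA.
  by rewrite hkap c0 c'0 scaler0 addr0.
have llin i k u v : A u -> A v -> l i (k *: u + v) = k * l i u + l i v.
  by move=> /Akap[c c0 <-] /Akap[c' c'0 <-]; rewrite -hphi hl.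
have A0 : A 0.
  have h : kappa 0 = 0.
    by have := hkap (-1) 0 0; rewrite !scaleN1r oppr0 addr0 addNr.
  have <- : phi 0 = 0 by have := hphi (-1) 0 0; rewrite !scaleN1r oppr0 addr0 addNr.
  exact: kapA.
have Asum (s : seq K) (c : K -> R) (e : K -> E) : (forall i, A (e i)) ->
    A (\sum_(i <- s) c i *: e i).
  move=> eA; elim: s => [|i s IH]; rewrite ?big_nil// big_cons; exact: Alin.
have l00 i : l i 0 = 0.
  by have := llin i (-1) 0 0 A0 A0; rewrite scaler0 addr0 mulN1r addNr.
have lsum j (s : seq K) (c : K -> R) (e : K -> E) : (forall i, A (e i)) ->
    l j (\sum_(i <- s) c i *: e i) = \sum_(i <- s) c i * l j (e i).
  move=> eA; elim: s => [|i s IH]; rewrite ?big_nil// !big_cons llin ?IH//.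
  exact: Asum.
have surj (w : K -> R) : exists2 u, A u & forall i, l i u = w i.
  pose L c : {ffun J + K -> R} := [ffun s => match s with
    | inl j => kappa c j | inr i => l i (phi c) end].
  have [| | |c cL] := @lin_inj_surj _ _ L _ _ _
      [ffun s => match s with inl _ => 0 | inr i => w i end].
  - by rewrite card_sum.
  - move=> k u v; apply/ffunP => -[j|i]; rewrite !ffunE ?hl//.
    by rewrite hkap !ffunE.
  - move=> c Lc0; have k0 : kappa c = 0.
      by apply/ffunP => j; have := congr1 (fun f : {ffun J + K -> R} => f (inl j)) Lc0; rewrite !ffunE.
    apply: phi0 => //; apply: l0; first exact: kapA.
    by move=> i; have := congr1 (fun f : {ffun J + K -> R} => f (inr i)) Lc0; rewrite !ffunE.
  - exists (phi c).
      apply: kapA; apply/ffunP => j.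
      by have := congr1 (fun f : {ffun J + K -> R} => f (inl j)) cL; rewrite !ffunE.
    by move=> i; have := congr1 (fun f : {ffun J + K -> R} => f (inr i)) cL; rewrite !ffunE.
(* The family [b] of elements of [A] dual to the forms [l] serves as the basis of [A], while the
   forms are the basis of the dual. *)
have /choice[b hb] : forall j, exists u, A u /\ forall i, l i u = (i == j)%:R.
  by move=> j; have [u uA ul] := surj (fun i => (i == j)%:R); exists u.
have bA j := (hb j).1; have lb i j : l i (b j) = (i == j)%:R := (hb j).2 i.
have pick (c : K -> R) j : \sum_i c i * l j (b i) = c j.
  rewrite (bigD1 j)//= lb eqxx mulr1 big1 ?addr0// => i ij.
  by rewrite lb eq_sym (negbTE ij) mulr0.
have uE u : A u -> u = \sum_i l i u *: b i.
  move=> uA; apply/eqP; rewrite -subr_eq0; apply/eqP.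
  rewrite -scaleN1r addrC; apply: l0; first by apply: Alin => //; exact: Asum.
  by move=> i; rewrite llin//; [rewrite lsum// pick mulN1r addNr|exact: Asum].
have basisb : is_basis A b.
  split => // u uA; exists [ffun i => l i u]; split.
    by rewrite {1}(uE u uA); apply: eq_bigr => i _; rewrite ffunE.
  by move=> c ->; apply/ffunP => i; rewrite ffunE lsum// pick.
split.
  exists (b \o enum_val); apply: is_basis_reindex basisb.
  - exact: enum_valK.
  - exact: enum_rankK.
pose B j : A := SigSub (mem_set (bA j)).
split => [i|f fdual]; first by move=> k u v w /= ->; apply: llin; exact: set_valP.
have fE u : f u = \sum_i l i (val u) * f (B i).
  (* A functional is linear on the subtype [A] only, so the sum is built by induction, each partial
     sum being bundled as an element of [A]. *)
  suff H (s : seq K) (c : K -> R) v : val v = \sum_(i <- s) c i *: b i ->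
      f v = \sum_(i <- s) c i * f (B i).
    by apply: H; apply: uE; exact: set_valP.
  elim: s v => [v|i s IH v]; rewrite ?big_nil ?big_cons => vE.
    have := fdual (-1) v v v; rewrite vE scaler0 addr0 mulN1r addNr; exact.
  pose t : A := SigSub (mem_set (Asum s c b bA)).
  by rewrite (fdual (c i) (B i) t)// (IH t).
exists [ffun i => f (B i)]; split.
  apply/funext => u; rewrite fE fct_sumE; apply: eq_bigr => i _.
  by rewrite ffunE mulrC.
move=> c fc; apply/ffunP => j; rewrite ffunE fc fct_sumE.
by rewrite (eq_bigr (fun i => c i * l i (b j)))// (bigD1 j)//= lb eqxx mulr1
  big1 ?addr0// => i ij; rewrite lb (negbTE ij) mulr0.
Qed.

End linear_algebra.

(** * The Clough--Tocher space *)

Section triangle_topology.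
Context {R : realType}.
Implicit Types (x y z v : 'cV[R]_2) (b : 'I_3 -> 'cV[R]_2).

Lemma continuous_bary b j : continuous (bary b j).
Proof.
have c i k : continuous (fun x => (b i - x) k 0).
  rewrite (_ : (fun x => _) = (fun x => b i k 0 - x k 0)); last first.
    by apply/funext => x; rewrite !mxE.
  by move=> x; apply: continuousB; [exact: cst_continuous|exact: coord_continuous].
pose f i k := (fun x => (b i - x) k 0) : 'cV[R]_2 -> R.
rewrite (_ : bary b j = (f (j + 1) 0 * f (j + 2%:R) 1 - f (j + 1) 1 * f (j + 2%:R) 0) *
  cst (area2 b)^-1)//.
move=> x; apply: continuousM; last exact: cst_continuous.
by apply: continuousB; apply: continuousM; exact: c.
Qed.

Lemma closed_conv_hull b : area2 b != 0 -> closed (conv_hull b).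
Proof.
move=> b0; rewrite (_ : conv_hull b = \bigcap_j (bary b j @^-1` [set t | 0 <= t])).
  apply: closed_bigI => j _; apply: closed_comp; last exact: closed_ge.
  by move=> x _; exact: continuous_bary.
by rewrite conv_hullE//; apply/seteqP; split => x /= h j; [move=> _|]; exact: h.
Qed.

Lemma conv_hull_nbhs b x : area2 b != 0 -> (forall j, 0 < bary b j x) ->
  nbhs x (conv_hull b).
Proof.
move=> b0 xb; rewrite conv_hullE//.
have h j : \forall y \near x, 0 < bary b j y.
  by apply: (@continuous_bary b j x _ (lt_nbhsr (xb j))).
near=> y => /=; elim/ord3_ind; apply: ltW; near: y; exact: h.
Unshelve. all: by end_near. Qed.

Lemma bary_affine b j x y t : area2 b != 0 ->
  bary b j (x + t *: (y - x)) = (1 - t) * bary b j x + t * bary b j y.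
Proof.
by move=> b0; rewrite /bary /cr !mxE; move: b0; rewrite /area2 /cr !mxE => b0; field.
Qed.

(** A small step of length factor t from [x] away from [b j] stays in the triangle, where coordinate
    j is (1+t) times that of [x], minus t; its nonnegativity forces that of [x] to be positive. *)
Lemma interior_bary b x j : area2 b != 0 -> (conv_hull b)° x -> 0 < bary b j x.
Proof.
move=> b0 bx.
have : \forall t \near 0^'+, conv_hull b (x + t *: (x - b j)).
  have : x + t *: (x - b j) @[t --> 0^'+] --> x + 0 *: (x - b j).
    by apply: cvg_within_filter; apply: cvgD; [exact: cvg_cst|apply: cvgZr_tmp].
  by rewrite scale0r addr0 => /(_ _ bx).
move=> /filterI /(_ (nbhs_right_gt 0)) /filter_ex[t [/= ht t0]].
have bb : bary b j (b j) = 1 by rewrite bary_vertex ?eqxx.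
move: ht; rewrite conv_hullE//= => /(_ j).
rewrite (_ : x + t *: (x - b j) = x + (- t) *: (b j - x)); last first.
  by rewrite scaleNr -scalerN opprB.
by rewrite bary_affine// bb; nra.
Qed.

End triangle_topology.

(** * Geometry of the three subtriangles *)

Section clough_tocher.
Context {R : realType}.
Variables (a : 'I_3 -> 'cV[R]_2) (z : 'cV[R]_2).
Hypothesis a0 : area2 a != 0.
Hypothesis za : forall j, 0 < bary a j z.
Implicit Types (x y v : 'cV[R]_2).
Local Notation s k := (a k - z).

Lemma cr_spoke i : cr (s (i + 1)) (s (i + 2%:R)) = bary a i z * area2 a.
Proof. by rewrite /bary divfK. Qed.

Lemma cr_spoke_neq0 i : cr (s (i + 1)) (s (i + 2%:R)) != 0.
Proof. by rewrite cr_spoke mulf_neq0// gt_eqF. Qed.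

Lemma area2_CT i : area2 (fun j => if j == i then z else a j) != 0.
Proof.
rewrite (_ : area2 _ = bary a i z * area2 a); first by rewrite mulf_neq0// gt_eqF.
rewrite -cr_spoke /area2 /cr; elim/ord3_ind : i; rewrite ?ord3D/= !mxE; ring.
Qed.

Lemma CTP i x : CT a z i x <-> exists p q,
  [/\ 0 <= p, 0 <= q, p + q <= 1 & x = z + (p *: s (i + 1) + q *: s (i + 2%:R))].
Proof.
split=> [[c [c0]]|[p [q [p0 q0 pq ->]]]].
  rewrite !sum3 => c1 ->; exists (c (i + 1)), (c (i + 2%:R)); split=> //.
    by move: (c0 0) (c0 1) (c0 2%:R) c1; elim/ord3_ind : i; rewrite ?ord3D/=; lra.
  have e : c 0 = 1 - c 1 - c 2%:R by rewrite -c1; ring.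
  by move: e; elim/ord3_ind : i; rewrite ?ord3D/= => e;
    apply: cV2P; rewrite !mxE e; ring.
exists (fun j => if j == i then 1 - p - q else if j == i + 1 then p else q); split.
- by move=> j; case: ifP => _; [lra|case: ifP].
- by rewrite sum3; elim/ord3_ind : i; rewrite ?ord3D/=; ring.
- by rewrite sum3; elim/ord3_ind : i; rewrite ?ord3D/=; apply: cV2P; rewrite !mxE; ring.
Qed.

Lemma CT_seg k t : 0 <= t <= 1 ->
  CT a z (k + 1) (seg z (a k) t) /\ CT a z (k + 2%:R) (seg z (a k) t).
Proof.
move=> /andP[t0 t1]; split; apply/CTP.
  exists 0, t; rewrite add0r scale0r add0r; split=> //.
  by elim/ord3_ind : k; rewrite ?ord3D.
exists t, 0; rewrite addr0 scale0r addr0; split=> //.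
by elim/ord3_ind : k; rewrite ?ord3D.
Qed.

(** The point is expressed in the spokes of both subtriangles. The cross product with the shared
    spoke leaves the weights of the other two, which lie on opposite sides of it, so these
    nonnegative weights vanish. *)
Lemma CT_inter k x : CT a z (k + 1) x -> CT a z (k + 2%:R) x ->
  exists2 t, 0 <= t <= 1 & x = seg z (a k) t.
Proof.
move=> /CTP[p [q [p0 q0 pq ->]]] /CTP[p' [q' [p'0 q'0 pq']]] /addrI e.
have {e} : cr (p *: s (k + 1 + 1) + q *: s (k + 1 + 2%:R)) (s k) =
  cr (p' *: s (k + 2%:R + 1) + q' *: s (k + 2%:R + 2%:R)) (s k) by rewrite e.
have -> : k + 1 + 1 = k + 2%:R by elim/ord3_ind : k; rewrite ?ord3D.
have -> : k + 1 + 2%:R = k by elim/ord3_ind : k; rewrite ?ord3D.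
have -> : k + 2%:R + 1 = k by elim/ord3_ind : k; rewrite ?ord3D.
have -> : k + 2%:R + 2%:R = k + 1 by elim/ord3_ind : k; rewrite ?ord3D.
have e1 := cr_spoke (k + 1); have e2 := cr_spoke (k + 2%:R); move: e1 e2.
have -> : k + 1 + 1 = k + 2%:R by elim/ord3_ind : k; rewrite ?ord3D.
have -> : k + 1 + 2%:R = k by elim/ord3_ind : k; rewrite ?ord3D.
have -> : k + 2%:R + 1 = k by elim/ord3_ind : k; rewrite ?ord3D.
have -> : k + 2%:R + 2%:R = k + 1 by elim/ord3_ind : k; rewrite ?ord3D.
move=> e1 e2 e.
have : p * cr (s (k + 2%:R)) (s k) + q' * cr (s k) (s (k + 1)) = 0.
  by move: e; rewrite /cr !mxE; lra.
rewrite e1 e2; have := za (k + 1); have := za (k + 2%:R).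
move: (bary a (k + 1) z) (bary a (k + 2%:R) z) => b1 b2 b20 b10 h.
have p00 : p = 0.
  have : (p * b1 + q' * b2) * area2 a = 0 by rewrite -h; ring.
  by move/eqP; rewrite mulf_eq0 (negbTE a0) orbF => /eqP ?; nra.
exists q; first by rewrite q0/=; lra.
by rewrite p00 scale0r add0r.
Qed.

Lemma CT_sub i : CT a z i `<=` conv_hull a.
Proof.
move=> x /CTP[p [q [p0 q0 pq ->]]].
exists (fun j => (1 - p - q) * bary a j z +
   (if j == i + 1 then p else if j == i + 2%:R then q else 0)); split.
- move=> j; apply: addr_ge0; first by apply: mulr_ge0; [lra|exact: ltW].
  by case: ifP => _ //; case: ifP.
- rewrite big_split/= -mulr_sumr sum_bary// sum3.
  by elim/ord3_ind : i; rewrite ?ord3D/=; ring.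
- under eq_bigr do rewrite scalerDl -scalerA.
  rewrite big_split/= -scaler_sumr sum_bary_scale// sum3.
  by elim/ord3_ind : i; rewrite ?ord3D/=; apply: cV2P; rewrite !mxE; ring.
Qed.

(** The index [i] minimizes the ratio of the coordinates of [x] to those of [z]. Subtracting this
    multiple of the coordinates of [z] leaves nonnegative numbers, with 0 at [i]: the weights of the
    two spokes of subtriangle [i]. *)
Lemma CT_cover x : conv_hull a x -> exists i, CT a z i x.
Proof.
rewrite conv_hullE//= => ax.
pose r j := bary a j x / bary a j z.
have [i _ imin] := @Order.TotalTheory.arg_minP _ R _ (0 : 'I_3) predT r isT.
exists i; apply/CTP.
have bz j : r j * bary a j z = bary a j x by rewrite /r divfK// gt_eqF.
have h j : 0 <= bary a j x - r i * bary a j z.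
  rewrite -(bz j) -mulrBl mulr_ge0//; last exact: ltW.
  by rewrite subr_ge0; exact: imin.
exists (bary a (i + 1) x - r i * bary a (i + 1) z),
  (bary a (i + 2%:R) x - r i * bary a (i + 2%:R) z); split; [exact: h|exact: h| |].
  rewrite (_ : _ + _ = \sum_j bary a j x - r i * \sum_j bary a j z).
    by rewrite !sum_bary// mulr1 gerBl divr_ge0// ltW.
  by rewrite !sum3; move: (bz i); elim/ord3_ind : (i); rewrite ?ord3D => <-; ring.
(* The coordinates of [z] combine the spokes to 0, so a multiple of them may be subtracted from
   those of [x]. *)
have xE : x = \sum_j bary a j x *: (a j - z) + z.
  under eq_bigr do rewrite scalerBr.
  by rewrite sumrB -scaler_suml sum_bary// sum_bary_scale// scale1r subrK.
have zE : 0 = \sum_j bary a j z *: (a j - z).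
  under eq_bigr do rewrite scalerBr.
  by rewrite sumrB -scaler_suml sum_bary// sum_bary_scale// scale1r subrr.
rewrite {1}xE addrC; congr (_ + _).
transitivity (\sum_j bary a j x *: (a j - z) - r i *: \sum_j bary a j z *: (a j - z)).
  by rewrite -zE scaler0 subr0.
rewrite !sum3; move: (bz i); elim/ord3_ind : (i); rewrite ?ord3D => <-;
  by apply: cV2P; rewrite !mxE; ring.
Qed.

End clough_tocher.

(** * Continuous gluing of pieces *)

Section smooth_gluing.
Context {R : realType}.
Variables (a : 'I_3 -> 'cV[R]_2) (z : 'cV[R]_2).
Hypothesis a0 : area2 a != 0.
Hypothesis za : forall j, 0 < bary a j z.
Implicit Types (x y v : 'cV[R]_2).

Lemma continuous_cub (k : @cubic R) v : continuous (fun x => cub k (x - v)).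
Proof.
have c i : continuous (fun x => (x - v) i 0).
  rewrite (_ : (fun x => _) = (fun x => x i 0 - v i 0)); last first.
    by apply/funext => x; rewrite !mxE.
  by move=> x; apply: continuousB; [exact: coord_continuous|exact: cst_continuous].
pose X : 'cV[R]_2 -> R := fun x => (x - v) 0 0.
pose Y : 'cV[R]_2 -> R := fun x => (x - v) 1 0.
have cX : continuous X := c 0.
have cY : continuous Y := c 1.
rewrite (_ : (fun x => _) = cst (k00 k) + cst (k10 k) * X + cst (k01 k) * Y
  + cst (k20 k) * (X * X) + cst (k11 k) * (X * Y) + cst (k02 k) * (Y * Y)
  + cst (k30 k) * (X * X * X) + cst (k21 k) * (X * X * Y)
  + cst (k12 k) * (X * Y * Y) + cst (k03 k) * (Y * Y * Y)); last first.
  apply/funext => x; rewrite /cub !fctE -/(X x) -/(Y x) /cst; ring.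
move=> x; repeat (apply: continuousD || apply: continuousM);
  solve [exact: cst_continuous|exact: cX|exact: cY].
Qed.

Lemma distinct_ord3 (i j : 'I_3) : i != j ->
  exists k, (i = k + 1 /\ j = k + 2%:R) \/ (j = k + 1 /\ i = k + 2%:R).
Proof.
elim/ord3_ind : i; elim/ord3_ind : j => // _.
- by exists 2%:R; left; rewrite !ord3D.
- by exists 1; right; rewrite !ord3D.
- by exists 2%:R; right; rewrite !ord3D.
- by exists 0; left; rewrite !ord3D.
- by exists 1; left; rewrite !ord3D.
- by exists 0; right; rewrite !ord3D.
Qed.

(** Two subtriangles meet in a spoke, so agreement there makes the choice of the piece immaterial;
    continuity then holds on a finite union of closed sets. *)
Lemma CT_glue (u : 'I_3 -> 'cV[R]_2 -> R) : (forall i, continuous (u i)) ->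
  (forall k t, 0 <= t <= 1 ->
    u (k + 1) (seg z (a k) t) = u (k + 2%:R) (seg z (a k) t)) ->
  exists f, (forall i x, CT a z i x -> f x = u i x) /\
    {within conv_hull a, continuous f}.
Proof.
move=> cu ucompat.
have uE i j x : CT a z i x -> CT a z j x -> u i x = u j x.
  have [->//|/distinct_ord3[k [[-> ->]|[-> ->]]]] := eqVneq i j => h1 h2.
    by have [t t01 ->] := CT_inter a0 za h1 h2; exact: ucompat.
  by have [t t01 ->] := CT_inter a0 za h2 h1; rewrite ucompat.
(* Off the triangle no index is found, and 0 is a default value. *)
pose f x := if [pick i | x \in CT a z i] is Some i then u i x else 0.
have fE i x : CT a z i x -> f x = u i x.
  move=> ix; rewrite /f; case: pickP => [j /set_mem jx|/(_ i)]; first exact: uE.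
  by rewrite mem_set.
exists f; split => //.
have -> : conv_hull a = CT a z 0 `|` CT a z 1 `|` CT a z 2%:R.
  apply/seteqP; split => [x /(CT_cover a0 za)[]|x].
    by elim/ord3_ind; [left; left|left; right|right].
  by move=> [[]|]; exact: CT_sub.
have cf i : {within CT a z i, continuous f}.
  apply: (@subspace_eq_continuous _ _ _ (u i)); last exact: continuous_subspaceT.
  by move=> x /set_mem/fE.
have cl i : closed (CT a z i) by apply: closed_conv_hull; exact: area2_CT.
apply: withinU_continuous => //; first exact: closedU.
exact: withinU_continuous.
Qed.

End smooth_gluing.

(** * Smoothness as polynomial identities along the spokes *)

Section clough_tocher_space.
Context {R : realType}.
Variables (a : 'I_3 -> 'cV[R]_2) (z : 'cV[R]_2).
Hypothesis a0 : area2 a != 0.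
Hypothesis za : forall j, 0 < bary a j z.
Implicit Types (x y s v : 'cV[R]_2) (c d : @cubic R).

(** The origin stands for [z]. Values are compared there only, since equal gradients propagate the
    equality; gradients are compared on the whole line, so that points beyond the spoke are
    available. *)
Definition C1_across s c d := cub c 0 = cub d 0 /\
  forall j t, cub (dcub j c) (t *: s) = cub (dcub j d) (t *: s).

(** Along the line the partial derivatives are quadratic in [t], so Lagrange interpolation at 0, 1/2
    and 1 determines them. *)
Lemma C1_across_intro s c d : cub c 0 = cub d 0 ->
  (forall j t, 0 <= t <= 1 -> cub (dcub j c) (t *: s) = cub (dcub j d) (t *: s)) ->
  C1_across s c d.
Proof.
move=> cd0 cd; split => // j t.
have lagrange e : cub (dcub j e) (t *: s) =
    (2 * t ^+ 2 - 3 * t + 1) * cub (dcub j e) (0 *: s) +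
    (4 * t - 4 * t ^+ 2) * cub (dcub j e) (2^-1 *: s) +
    (2 * t ^+ 2 - t) * cub (dcub j e) (1 *: s).
  by elim/ord2_ind : j {cd} => /=; rewrite /cub/= !mxE; field.
by rewrite !lagrange !cd//; lra.
Qed.

(** The value is the integral of the derivative along the spoke, which Simpson's rule gives
    exactly. *)
Lemma C1_across_val s c d t : C1_across s c d -> cub c (t *: s) = cub d (t *: s).
Proof.
move=> [cd0 cd].
have simpson e : cub e (t *: s) = cub e 0 + t / 6 *
   (s 0 0 * (cub (dcub 0 e) (0 *: s) + 4 * cub (dcub 0 e) ((t / 2) *: s) + cub (dcub 0 e) (t *: s))
  + s 1 0 * (cub (dcub 1 e) (0 *: s) + 4 * cub (dcub 1 e) ((t / 2) *: s) + cub (dcub 1 e) (t *: s))).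
  by rewrite /cub/= !mxE; field.
by rewrite simpson [RHS]simpson !cd cd0.
Qed.

(** In the interior of a subtriangle [f] coincides locally with its piece. A boundary point is
    reached along the segment to the centroid [m], which is interior up to that point, by continuity
    of [g j]. *)
Lemma C1_on_gradient (f : 'cV[R]_2 -> R) (g : 'I_2 -> 'cV[R]_2 -> R) (c : 'I_3 -> cubic) i j x :
  {within conv_hull a, continuous (g j)} ->
  (forall x, (conv_hull a)° x -> is_derive x (delta_mx j 0) f (g j x)) ->
  (forall x, CT a z i x -> f x = cub (c i) (x - z)) ->
  CT a z i x -> g j x = cub (dcub j (c i)) (x - z).
Proof.
move=> cg df fc xi.
pose b := fun l => if l == i then z else a l.
have b0 : area2 b != 0 := area2_CT a0 za i.
pose m := \sum_l 3^-1 *: b l.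
have bm l : bary b l m = 3^-1.
  by rewrite /m (bary_conv (c := fun=> 3^-1))// sum3; field.
pose p t := x + t *: (m - x).
have pb t : 0 < t <= 1 -> nbhs (p t) (CT a z i).
  move=> /andP[t0 t1]; apply: conv_hull_nbhs => // l; rewrite bary_affine// bm.
  have : 0 <= bary b l x by move: xi; rewrite /CT conv_hullE//; exact.
  by move=> ?; nra.
have gp t : 0 < t <= 1 -> g j (p t) = cub (dcub j (c i)) (p t - z).
  move=> /pb pt.
  have pT : (conv_hull a)° (p t).
    by rewrite /interior; apply: filterS pt; exact: CT_sub.
  have [_ <-] := df _ pT.
  rewrite (@near_eq_derive _ _ _ f (fun x => cub (c i) (x - z))).
    exact: (congr1 (fun h => h (p t)) (partial_cub j (c i) z)).
  by apply: filterS pt => y; exact: fc.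
have p0 : p t @[t --> 0^'+] --> x.
  rewrite -[X in _ --> X]addr0 -(scale0r (m - x)).
  by apply: cvg_within_filter; apply: cvgD; [exact: cvg_cst|apply: cvgZr_tmp].
have near01 : \forall t \near (0:R)^'+, 0 < t <= 1.
  near=> t; apply/andP; split; first by near: t; exact: nbhs_right_gt.
  by near: t; apply: nbhs_right_le.
have lim1 : cub (dcub j (c i)) (p t - z) @[t --> 0^'+] --> cub (dcub j (c i)) (x - z).
  exact: (cvg_comp _ _ p0 (@continuous_cub _ (dcub j (c i)) z x)).
have lim2 : g j (p t) @[t --> 0^'+] --> g j x.
  move/subspace_continuousP : cg => /(_ x (CT_sub a0 za xi)); apply: cvg_comp.
  move=> /= A /= nA; apply: filterS2 near01 (p0 _ nA) => t /pb /nbhs_singleton pt.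
  by apply; exact: CT_sub pt.
apply: (cvg_unique _ lim2); first exact: norm_hausdorff.
apply: cvg_trans lim1; apply: near_eq_cvg.
by near do rewrite gp//.
Unshelve. all: by end_near. Qed.

(** The difference quotient is that of whichever piece contains the moving point. The pieces through
    [x] all have the partial derivative [g j x]; the other subtriangles, being closed, are missed
    for small h. *)
Lemma C1_on_glue (c : 'I_3 -> cubic) (f : 'cV[R]_2 -> R) (g : 'I_2 -> 'cV[R]_2 -> R) x j :
  (forall i x, CT a z i x -> f x = cub (c i) (x - z)) ->
  (forall i x, CT a z i x -> g j x = cub (dcub j (c i)) (x - z)) ->
  (conv_hull a)° x -> is_derive x (delta_mx j 0) f (g j x).
Proof.
move=> fc gc xT; pose e : 'cV[R]_2 := delta_mx j 0.
suff cv : h^-1 *: ((f \o shift x) (h *: e) - f x) @[h --> 0^'] --> g j x.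
  by apply: DeriveDef; [apply/cvg_ex; exists (g j x)|exact: cvg_lim].
have path : h *: e + x @[h --> 0^'] --> x.
  rewrite -[X in _ --> X]add0r -(scale0r e).
  by apply: cvg_within_filter; apply: cvgD; [apply: cvgZr_tmp|exact: cvg_cst].
apply/cvgrPdist_lt => eps eps0.
have H i : \forall h \near 0^', CT a z i (h *: e + x) ->
    `|g j x - h^-1 *: ((f \o shift x) (h *: e) - f x)| < eps.
  have [xi|xi] := pselect (CT a z i x).
    have [du Du] := is_derive_cub (c i) z x e.
    have /cvgrPdist_lt /(_ _ eps0) := du.
    have Dg : 'D_e (fun x => cub (c i) (x - z)) x = g j x.
      by rewrite (gc i)//; exact: (congr1 (fun h => h x) (partial_cub j (c i) z)).
    apply: filterS => h /[swap] hi.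
    by rewrite -[lim _]/('D_e (fun x => cub (c i) (x - z)) x) Dg /= !(fc i).
  have : closed (CT a z i) by apply: closed_conv_hull; exact: area2_CT.
  move=> /closed_openC; rewrite openE => /(_ x xi) /path xi'.
  have : \forall h \near 0^', ~ CT a z i (h *: e + x) by exact: xi'.
  by apply: filterS => h.
have TT : \forall h \near 0^', conv_hull a (h *: e + x) by exact: (path _ xT).
near=> h.
have [i hi] : exists i, CT a z i (h *: e + x) by apply: CT_cover => //; near: h.
move: i hi; apply: ord3_ind; near: h; exact: H.
Unshelve. all: by end_near. Qed.

(** In one direction the extended gradient equals that of both pieces on a common spoke; in the
    other, the values and each partial derivative are glued separately. *)
Lemma A0P u : A0 a z u <-> exists c : 'I_3 -> cubic,
  u = (fun i x => cub (c i) (x - z)) /\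
  forall k, C1_across (a k - z) (c (k + 1)) (c (k + 2%:R)).
Proof.
have segz k t : seg z (a k) t - z = t *: (a k - z) by rewrite /seg addrC addKr.
split=> [[upoly [f [fu [cf [g gf]]]]]|[c [-> cc]]].
  have /choice[c cu] : forall i, exists c, u i = fun x => cub c (x - z).
    by move=> i; apply/is_poly3P.
  have uE : u = (fun i x => cub (c i) (x - z)) by apply/funext => i; rewrite cu.
  exists c; split => // k; subst u.
  have gc i j x : CT a z i x -> g j x = cub (dcub j (c i)) (x - z).
    by have [cg dg] := gf j; apply: (C1_on_gradient cg dg) => y; exact: fu.
  apply: C1_across_intro => [|j t t01].
    have t0 : 0 <= (0 : R) <= 1 by rewrite lexx ler01.
    have [h1 h2] := CT_seg a z k t0.
    by move: (fu _ _ h1); rewrite (fu _ _ h2) segz scale0r => ->.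
  by have [h1 h2] := CT_seg a z k t01; rewrite -segz -!gc.
split=> [i|]; first by apply/is_poly3P; exists (c i).
have [f [fu cf]] : exists f, (forall i x, CT a z i x -> f x = cub (c i) (x - z)) /\
    {within conv_hull a, continuous f}.
  apply: CT_glue => // [i|k t t01]; first exact: continuous_cub.
  by rewrite segz; exact: C1_across_val.
have /choice[g gP] : forall j, exists g,
    (forall i x, CT a z i x -> g x = cub (dcub j (c i)) (x - z)) /\
    {within conv_hull a, continuous g}.
  move=> j; apply: CT_glue => // [i|k t t01]; first exact: continuous_cub.
  by rewrite segz; case: (cc k) => _ ->.
exists f; split => //; split => //; exists g => j; split; first by case: (gP j).
by move=> x xT; apply: (C1_on_glue (c := c)) => //; case: (gP j).
Qed.

End clough_tocher_space.

(** * Symmetric matrix fields *)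

Section symmetric_fields.
Context {R : realType}.
Implicit Types (s u v w x y z : 'cV[R]_2) (M N : 'M[R]_2).

Lemma dotE u v : dot u v = u 0 0 * v 0 0 + u 1 0 * v 1 0.
Proof. by rewrite /dot /mxtrace big_ord1 mxE sum2 !mxE. Qed.

Lemma dotmxE M N : dot M N = M 0 0 * N 0 0 + M 0 1 * N 0 1 + M 1 0 * N 1 0 + M 1 1 * N 1 1.
Proof. by rewrite /dot /mxtrace sum2 !mxE !sum2 !mxE; ring. Qed.

Lemma mulmxE M u i : (M *m u) i 0 = M i 0 * u 0 0 + M i 1 * u 1 0.
Proof. by rewrite mxE sum2. Qed.

Lemma M2P M N : M 0 0 = N 0 0 -> M 0 1 = N 0 1 -> M 1 0 = N 1 0 -> M 1 1 = N 1 1 -> M = N.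
Proof.
move=> h1 h2 h3 h4; apply/matrixP => i j.
by elim/ord2_ind : i; elim/ord2_ind : j.
Qed.

Lemma dot_eq0 u : dot u u = 0 -> u = 0.
Proof. by rewrite dotE => h; apply: cV2P; rewrite mxE; nra. Qed.

Lemma dotmx_eq0 M : dot M M = 0 -> M = 0.
Proof. by rewrite dotmxE => h; apply: M2P; rewrite mxE; nra. Qed.

(** The quarter turn: [rot e] is normal to [e], and unit normals are nonzero multiples of it, which
    keeps square roots out of the algebra. *)
Definition rot u : 'cV[R]_2 := \col_i (if i == 0 then - u 1 0 else u 0 0).

Lemma cr_rot u v : cr (rot u) (rot v) = cr u v.
Proof. by rewrite /cr !mxE/=; ring. Qed.

Lemma unit_normalP n e : e != 0 -> unit_normal n e ->
  exists2 m, m != 0 & n = m *: rot e.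
Proof.
move=> e0 []; rewrite !dotE => nn ne.
have ee : dot e e != 0 by apply: contra e0 => /eqP/dot_eq0 ->.
(* Lagrange's identity for [e] and [n], with [n] of length 1 and orthogonal to [e]. *)
have cc : dot e e = cr e n ^+ 2 by rewrite dotE /cr; nra.
exists (cr e n / dot e e).
  rewrite mulf_neq0 ?invr_neq0//.
  by apply: contra ee => /eqP h; rewrite cc h expr0n.
have h i : e i 0 * (n 0 0 * e 0 0 + n 1 0 * e 1 0) = 0 by rewrite ne mulr0.
apply: cV2P; rewrite !mxE/=; apply: (mulIf ee); rewrite mulrAC divfK// dotE /cr.
- by have := h 0; lra.
- by have := h 1; lra.
Qed.

Lemma exists_unit_normal e : e != 0 -> exists2 n, unit_normal n e &
  exists2 m, m != 0 & n = m *: rot e.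
Proof.
move=> e0; have ee : 0 < dot e e.
  have : dot e e != 0 by apply: contra e0 => /eqP/dot_eq0 ->.
  by rewrite lt_def => ->; rewrite dotE; nra.
pose m := (Num.sqrt (dot e e))^-1.
have mm : m ^+ 2 * dot e e = 1.
  by rewrite /m exprVn sqr_sqrtr ?ltW// mulVf// gt_eqF.
exists (m *: rot e); last by exists m; rewrite // invr_neq0// gt_eqF// sqrtr_gt0.
by split; rewrite ?dotE; move: mm; rewrite ?dotE !mxE/=; nra.
Qed.

Lemma cr_neq0_dot_eq0 u v w : cr u v != 0 -> dot u w = 0 -> dot v w = 0 -> w = 0.
Proof.
rewrite !dotE /cr => uv uw vw; apply: cV2P; rewrite mxE; apply: (mulfI uv); rewrite mulr0.
- by transitivity (v 1 0 * (u 0 0 * w 0 0 + u 1 0 * w 1 0) -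
    u 1 0 * (v 0 0 * w 0 0 + v 1 0 * w 1 0)); [ring|rewrite uw vw; ring].
- by transitivity (u 0 0 * (v 0 0 * w 0 0 + v 1 0 * w 1 0) -
    v 0 0 * (u 0 0 * w 0 0 + u 1 0 * w 1 0)); [ring|rewrite uw vw; ring].
Qed.

Lemma mulmx_cr_eq0 M u v : cr u v != 0 -> M *m u = 0 -> M *m v = 0 -> M = 0.
Proof.
move=> uv Mu Mv.
suff h i : (row i M)^T = 0.
  by apply/row_matrixP => i; rewrite row0 -[row i M]trmxK h trmx0.
by apply: (cr_neq0_dot_eq0 uv); rewrite dotE !mxE; [move: Mu|move: Mv] =>
  /(congr1 (fun w : 'cV_2 => w i 0)); rewrite mulmxE mxE => <-; ring.
Qed.

Lemma dot_sym M u v : M^T = M -> dot u (M *m v) = dot v (M *m u).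
Proof.
move=> Ms; rewrite !dotE !mulmxE.
have -> : M 1 0 = M 0 1 by rewrite -{1}Ms mxE.
ring.
Qed.

Lemma dot0r u : dot u 0 = 0.
Proof. by rewrite dotE !mxE !mulr0 addr0. Qed.

(** The situation at a vertex of the triangle, with [u], [v] normal to the edges and [s] to the
    spoke. By symmetry [N *m u] is orthogonal to [v], and also to [s] since N s = M s and M u = 0;
    hence N u = 0. *)
Lemma sym_pair_eq0 M N u v s : M^T = M -> N^T = N ->
  cr u v != 0 -> cr u s != 0 -> cr v s != 0 ->
  M *m u = 0 -> N *m v = 0 -> M *m s = N *m s -> M = 0 /\ N = 0.
Proof.
move=> Ms Ns uv us vs Mu Nv MN.
have Nu : N *m u = 0.
  apply: (cr_neq0_dot_eq0 vs); rewrite dot_sym//.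
    by rewrite Nv dot0r.
  by rewrite -MN dot_sym// Mu dot0r.
have N0 : N = 0 by exact: mulmx_cr_eq0 uv Nu Nv.
by split => //; apply: (mulmx_cr_eq0 us) => //; rewrite MN N0 mul0mx.
Qed.

(** The situation of the three jumps at [z]. By symmetry P u = - N u is orthogonal to [v], and also
    to [w] as P w = 0; hence P u = 0. *)
Lemma sym_triple_eq0 M N P u v w : M^T = M -> N^T = N -> P^T = P ->
  cr v w != 0 -> cr u w != 0 -> M *m u = 0 -> N *m v = 0 -> P *m w = 0 ->
  M + N + P = 0 -> P = 0.
Proof.
move=> Ms Ns Ps vw uw Mu Nv Pw MNP.
have PE : P = - (M + N) by apply/eqP; rewrite -addr_eq0 addrC MNP.
have Pu : P *m u = (- N) *m u.
  by rewrite PE opprD mulmxDl !mulNmx Mu oppr0 add0r.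
apply: (mulmx_cr_eq0 uw) => //; apply: (cr_neq0_dot_eq0 vw).
  rewrite Pu dot_sym; last by rewrite linearN/= Ns.
  by rewrite mulNmx Nv oppr0 dot0r.
by rewrite dot_sym// Pw dot0r.
Qed.

(* The symmetric matrix field with affine entries; the rows of [c] are the
   entries 11, 12 and 22. *)
Definition sfield (c : 'I_3 -> 'I_3 -> R) y : 'M[R]_2 :=
  \matrix_(i, j) let r := if i == 0 then if j == 0 then 0 else 1
    else if j == 0 then 1 else 2%:R in affine (c r 0, c r 1, c r 2%:R) y.

Lemma sfield_sym c y : (sfield c y)^T = sfield c y.
Proof. by apply: M2P; rewrite !mxE. Qed.

Lemma sfield_lin c u v t : sfield c (u + t *: (v - u)) =
  (1 - t) *: sfield c u + t *: sfield c v.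
Proof. by apply: M2P; rewrite !mxE /affine/= !mxE; ring. Qed.

Lemma sfieldP z f : is_polymx 1 f -> (forall x, (f x)^T = f x) ->
  exists c, f = fun x => sfield c (x - z).
Proof.
move=> fp fs.
have h i j : exists p, (fun x => f x i j) = fun x => affine p (x - z).
  by apply/is_poly1P.
have [p pE] := h 0 0; have [q qE] := h 0 1; have [r rE] := h 1 1.
pose e (p : R * R * R) (l : 'I_3) := if l == 0 then p.1.1 else if l == 1 then p.1.2 else p.2.
exists (fun k => e (if k == 0 then p else if k == 1 then q else r)).
apply/funext => x; apply: M2P; rewrite !mxE/=.
- by rewrite (congr1 (fun g => g x) pE).
- by rewrite (congr1 (fun g => g x) qE).
- by rewrite -fs mxE (congr1 (fun g => g x) qE).
- by rewrite (congr1 (fun g => g x) rE).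
Qed.

Lemma is_polymx_sfield c z : is_polymx 1 (fun x => sfield c (x - z)).
Proof.
move=> i j; apply/(is_poly1P z).
exists (let r := if i == 0 then if j == 0 then 0 else 1
    else if j == 0 then 1 else 2%:R in (c r 0, c r 1, c r 2%:R)).
by apply/funext => x; rewrite mxE.
Qed.

Definition normal_cont s c d := forall t,
  sfield c (t *: s) *m rot s = sfield d (t *: s) *m rot s.

(** Normal components are affine along a spoke, so the two ends of the segment determine them on the
    whole line. *)
Lemma A1P (a : 'I_3 -> 'cV[R]_2) z (u : 'I_3 -> 'cV[R]_2 -> 'M[R]_2) : (forall k, a k - z != 0) ->
  (A1 a z u <-> exists c : 'I_3 -> 'I_3 -> 'I_3 -> R,
    u = (fun i x => sfield (c i) (x - z)) /\
    forall k, normal_cont (a k - z) (c (k + 1)) (c (k + 2%:R))).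
Proof.
move=> az; have segz k t : seg z (a k) t - z = t *: (a k - z).
  by rewrite /seg addrC addKr.
split=> [[up us un]|[c [-> cn]]].
  have /choice[c cu] : forall i, exists c, u i = fun x => sfield c (x - z).
    by move=> i; exact: sfieldP.
  have uE : u = (fun i x => sfield (c i) (x - z)) by apply/funext => i; rewrite cu.
  exists c; split => // k; subst u.
  have [n nn [m m0 nE]] := exists_unit_normal (az k).
  have h t : 0 <= t <= 1 -> sfield (c (k + 1)) (t *: (a k - z)) *m rot (a k - z) =
     sfield (c (k + 2%:R)) (t *: (a k - z)) *m rot (a k - z).
    move=> /(un _ _ _ nn); rewrite !segz nE -!scalemxAr.
    exact: scalerI.
  have lin d t : sfield d (t *: (a k - z)) = (1 - t) *: sfield d (0 *: (a k - z)) +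
      t *: sfield d (1 *: (a k - z)).
    by rewrite -sfield_lin scale1r scale0r subr0 add0r.
  by move=> t; rewrite !(lin _ t) !mulmxDl -!scalemxAl !h// lexx ler01.
split=> [i|i x|k n t nn _].
- exact: is_polymx_sfield.
- exact: sfield_sym.
- by have [m m0 ->] := unit_normalP (az k) nn; rewrite !segz -!scalemxAr cn.
Qed.

End symmetric_fields.

(** * Affine fields and their edge moments *)

Section affine_fields.
Context {R : realType}.
Implicit Types (p q x y z : 'cV[R]_2) (a b : 'I_3 -> 'cV[R]_2).

Lemma is_poly1_lin (f g : 'cV[R]_2 -> R) k :
  is_poly 1 f -> is_poly 1 g -> is_poly 1 (fun x => k * f x + g x).
Proof.
move=> /(is_poly1P 0)[[[f0 f1] f2] ->] /(is_poly1P 0)[[[g0 g1] g2] ->].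
apply/(is_poly1P 0); exists (k * f0 + g0, k * f1 + g1, k * f2 + g2).
by apply/funext => x; rewrite /affine/=; ring.
Qed.

Lemma is_poly1_cst k : @is_poly R 1 (fun=> k).
Proof.
apply/(is_poly1P 0); exists (k, 0, 0).
by apply/funext => x; rewrite /affine/=; ring.
Qed.

Lemma is_poly1_seg (f : 'cV[R]_2 -> R) p q t : is_poly 1 f ->
  f (seg p q t) = (1 - t) * f p + t * f q.
Proof.
by move=> /(is_poly1P 0)[c ->]; rewrite /affine/= !mxE; ring.
Qed.

Lemma is_poly1_bary b j : is_poly 1 (bary b j).
Proof.
apply/(is_poly1P 0); pose p := b (j + 1); pose q := b (j + 2%:R).
exists (cr p q / area2 b, (p 1 0 - q 1 0) / area2 b, (q 0 0 - p 0 0) / area2 b).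
by apply/funext => x; rewrite /bary -/p -/q /cr /affine/= !mxE; ring.
Qed.

Lemma is_polymx1_seg m n (f : 'cV[R]_2 -> 'M[R]_(m, n)) p q t : is_polymx 1 f ->
  f (seg p q t) = (1 - t) *: f p + t *: f q.
Proof.
by move=> hf; apply/matrixP => i j; rewrite !mxE (is_poly1_seg _ _ _ (hf i j)).
Qed.

Lemma edge_pt0 a i : edge_pt a i 0 = a (i + 1).
Proof. by rewrite /edge_pt /seg scale0r addr0. Qed.

Lemma edge_pt1 a i : edge_pt a i 1 = a (i + 2%:R).
Proof. by rewrite /edge_pt /seg scale1r addrC subrK. Qed.

(** The weights 2, 1, 1, 2 over 6 form the mass matrix of affine functions on a segment. *)
Lemma edge_int_dot a i (f : 'cV[R]_2 -> R) (F G : 'cV[R]_2 -> 'cV[R]_2) :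
  is_polymx 1 F -> is_polymx 1 G ->
  (forall x, edge a i x -> f x = dot (F x) (G x)) ->
  edge_int a i f = Num.sqrt (dot (edge_vec a i) (edge_vec a i)) / 6 *
    (2 * dot (F (a (i + 1))) (G (a (i + 1))) + dot (F (a (i + 1))) (G (a (i + 2%:R)))
    + dot (F (a (i + 2%:R))) (G (a (i + 1))) + 2 * dot (F (a (i + 2%:R))) (G (a (i + 2%:R)))).
Proof.
move=> hF hG fE.
pose A := F (a (i + 1)); pose B := F (a (i + 2%:R)).
pose C := G (a (i + 1)); pose D := G (a (i + 2%:R)).
have gE t : dot (F (edge_pt a i t)) (G (edge_pt a i t)) =
    dot A C + (dot A D + dot B C - 2 * dot A C) * t +
    (dot A C - dot A D - dot B C + dot B D) * t ^+ 2.
  by rewrite /edge_pt !is_polymx1_seg// -/A -/B -/C -/D !dotE !mxE; ring.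
rewrite (@edge_int_quadratic _ a i f (fun x => dot (F x) (G x))).
- by rewrite !gE -/A -/B -/C -/D; field.
- by do 3 eexists; exact: gE.
- by move=> t t01; apply: fE; exists t => //=; rewrite in_itv.
Qed.

Lemma sqrt_edge_neq0 (e : 'cV[R]_2) : e != 0 -> Num.sqrt (dot e e) / 6 != 0.
Proof.
move=> e0; rewrite mulf_neq0 ?invr_neq0// sqrtr_eq0 -ltNge lt_def.
by rewrite (contra_neq (@dot_eq0 _ e) e0) dotE; nra.
Qed.

Lemma A2P u : @A2 R u -> exists v, u = fun k => cst (v k).
Proof.
move=> Au; suff /choice[v vE] : forall k, exists v, u k = cst v by exists v; exact/funext.
move=> k; have /choice[c cE] : forall j, exists c, (fun x => u k x j 0) = cst c.
  by move=> j; apply/is_poly0P; exact: Au.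
exists (\col_j c j); apply/funext => x; apply/matrixP => j l.
by rewrite mxE ord1 (congr1 (fun f => f x) (cE j)).
Qed.

Lemma ffun_lin (I : finType) k (u v : {ffun I -> R}) i :
  (k *: u + v) i = k * u i + v i.
Proof. by rewrite !ffunE. Qed.

Lemma is_basis_span (E : lmodType R) (I : finType) (A : set E) (b : I -> E) u :
  is_basis A b -> A u -> exists c : I -> R, u = \sum_i c i *: b i.
Proof. by move=> [_ h] /h[c [-> _]]; exists c. Qed.

End affine_fields.

(** * Hat fields, and unisolvence for piecewise constants *)

Section spaces.
Context {R : realType}.
Variables (a : 'I_3 -> 'cV[R]_2) (z : 'cV[R]_2).
Hypothesis a0 : area2 a != 0.
Hypothesis za : forall j, 0 < bary a j z.
Implicit Types (x y v : 'cV[R]_2).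
Local Notation s k := (a k - z).

Lemma ord3DA (k : 'I_3) : ((k + 1 + 1)%R = k + 2%:R) * ((k + 1 + 2%:R)%R = k) *
  ((k + 2%:R + 1)%R = k) * ((k + 2%:R + 2%:R)%R = k + 1).
Proof. by elim/ord3_ind : k; rewrite !ord3D. Qed.

Lemma spoke_neq0 k : s k != 0.
Proof.
have := cr_spoke_neq0 a0 za (k + 1); rewrite ord3DA ord3DA.
by apply: contra => /eqP ->; rewrite /cr !mxE !mulr0 subr0.
Qed.

Lemma cr_edges k : cr (edge_vec a (k + 1)) (edge_vec a (k + 2%:R)) != 0.
Proof.
apply: contra a0 => /eqP h; rewrite -h /edge_vec !ord3DA /area2 /cr.
by apply/eqP; elim/ord3_ind : (k); rewrite ?ord3D !mxE; ring.
Qed.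

Lemma edge_vec_neq0 k : edge_vec a k != 0.
Proof.
have := cr_edges (k + 1); rewrite !ord3DA.
by apply: contra => /eqP ->; rewrite /cr !mxE !mulr0 subr0.
Qed.

(** The edge is a difference of two spokes, one of them [s k], so up to sign this is the cross
    product of two distinct spokes. *)
Lemma cr_edge_spoke1 k : cr (edge_vec a (k + 1)) (s k) != 0.
Proof.
have := cr_spoke_neq0 a0 za (k + 1); rewrite /edge_vec !ord3DA -oppr_eq0.
by apply: contra => /eqP h; rewrite -h /cr !mxE; apply/eqP; ring.
Qed.

Lemma cr_edge_spoke2 k : cr (edge_vec a (k + 2%:R)) (s k) != 0.
Proof.
have := cr_spoke_neq0 a0 za (k + 2%:R); rewrite /edge_vec !ord3DA -oppr_eq0.
by apply: contra => /eqP h; rewrite -h /cr !mxE; apply/eqP; ring.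
Qed.

(* A field without normal component on the boundary is a multiple of the hat
   function of [z]. *)
Lemma normal_cont_bubble (c : 'I_3 -> 'I_3 -> 'I_3 -> R) :
  (forall k, normal_cont (s k) (c (k + 1)) (c (k + 2%:R))) ->
  (forall i, sfield (c i) (s (i + 1)) *m rot (edge_vec a i) = 0 /\
             sfield (c i) (s (i + 2%:R)) *m rot (edge_vec a i) = 0) ->
  (forall i, sfield (c i) (s (i + 1)) = 0 /\ sfield (c i) (s (i + 2%:R)) = 0) /\
  (forall i, sfield (c i) 0 = sfield (c 0) 0).
Proof.
move=> cn cb; split.
  (* At the vertex [a k] each adjacent piece annihilates the normal of its own edge, and both agree
     on the normal of the spoke. *)
  have h k : sfield (c (k + 1)) (s k) = 0 /\ sfield (c (k + 2%:R)) (s k) = 0.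
    have [_ h1] := cb (k + 1); have [h2 _] := cb (k + 2%:R).
    rewrite ord3DA in h1; rewrite ord3DA in h2.
    have h3 := cn k 1; rewrite scale1r in h3.
    apply: (sym_pair_eq0 _ _ _ _ _ h1 h2 h3); rewrite ?sfield_sym ?cr_rot//.
    - exact: cr_edges.
    - exact: cr_edge_spoke1.
    - exact: cr_edge_spoke2.
  move=> i; split; [have [_] := h (i + 1)|have [] := h (i + 2%:R)]; by rewrite ord3DA.
(* The jumps at [z] across the three spokes telescope to 0. *)
pose M k := sfield (c (k + 1)) 0 - sfield (c (k + 2%:R)) 0.
have Ms k : (M k)^T = M k by rewrite /M linearB/= !sfield_sym.
have Mk k : M k *m rot (s k) = 0.
  by have := cn k 0; rewrite scale0r /M mulmxBl => ->; rewrite subrr.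
have M0 k : M k = 0.
  apply: (sym_triple_eq0 (Ms (k + 1)) (Ms (k + 2%:R)) (Ms k) _ _ (Mk _) (Mk _) (Mk _)).
  - by rewrite cr_rot; have := cr_spoke_neq0 a0 za (k + 1); rewrite !ord3DA.
  - rewrite cr_rot; have := cr_spoke_neq0 a0 za (k + 2%:R); rewrite !ord3DA -oppr_eq0.
    by apply: contra => /eqP h; rewrite -h /cr; apply/eqP; ring.
  - rewrite /M !ord3DA.
    move: (sfield (c (k + 1)) 0) (sfield (c (k + 2%:R)) 0) (sfield (c k) 0) => A B C.
    by apply/matrixP => i j; rewrite !mxE; ring.
have h k : sfield (c (k + 1)) 0 = sfield (c (k + 2%:R)) 0.
  by apply/eqP; rewrite -subr_eq0; exact/eqP/M0.
elim/ord3_ind => //.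
- by have := h 2%:R; rewrite !ord3D.
- by have := h 1; rewrite !ord3D.
Qed.

Lemma sfield_vertices_eq0 i (c : 'I_3 -> 'I_3 -> R) : sfield c 0 = 0 ->
  sfield c (s (i + 1)) = 0 -> sfield c (s (i + 2%:R)) = 0 -> forall y, sfield c y = 0.
Proof.
move=> h0 h1 h2 y; rewrite -[y](addrK z); apply/matrixP => j l; rewrite [RHS]mxE.
rewrite (is_poly1_interp _ (area2_CT a0 za i) (is_polymx_sfield c z j l)).
rewrite big1// => k _; suff -> : sfield c ((if k == i then z else a k) - z) = 0.
  by rewrite mxE mulr0.
case: eqVneq => [_|ki]; first by rewrite subrr.
by move: h1 h2; elim/ord3_ind : i k ki; elim/ord3_ind; rewrite ?ord3D.
Qed.

Lemma pw_quadrature : exists w : 'I_3 -> R, forall k, 0 < w k /\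
  forall f g : 'cV[R]_2 -> R, is_poly 1 g -> (forall x, CT a z k x -> f x = g x) ->
  area_int (CT a z k) f = w k * (g z + g (a (k + 1)) + g (a (k + 2%:R))).
Proof.
suff /choice[w hw] : forall k, exists w, 0 < w /\ forall f g : 'cV[R]_2 -> R,
    is_poly 1 g -> (forall x, CT a z k x -> f x = g x) ->
    area_int (CT a z k) f = w * (g z + g (a (k + 1)) + g (a (k + 2%:R))) by exists w.
move=> k; have [w w0 hw] := area_int_affine (area2_CT a0 za k).
exists w; split => // f g gp fg; rewrite (hw f g gp fg) sum3.
by elim/ord3_ind : k {hw fg}; rewrite ?ord3D/=; ring.
Qed.

Lemma conv_hull_vertex i : conv_hull a (a i).
Proof.
exists (fun j => (j == i)%:R); split => [j||]; first exact: ler0n.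
  by rewrite (bigD1 i)//= eqxx big1 ?addr0// => j /negbTE ->.
by rewrite (bigD1 i)//= eqxx scale1r big1 ?addr0// => j /negbTE ->; rewrite scale0r.
Qed.

Lemma conv_hull_center : conv_hull a z.
Proof. by rewrite conv_hullE// => j; exact/ltW. Qed.

Lemma A2_unisolvent (vT : 'I_6 -> 'cV[R]_2 -> 'cV[R]_2) :
  is_basis (P_V 1 (conv_hull a)) vT ->
  has_dim (@A2 R) 6 /\ unisolvent (@A2 R) (dofs2 a z vT).
Proof.
move=> bT; have [w hw] := pw_quadrature.
(* [P l] is the polynomial whose restriction is the test function [vT l]. *)
have /choice[P hP] : forall l, exists p, is_polymx 1 p /\
    forall x, conv_hull a x -> vT l x = p x.
  move=> l; have [+ _] := bT => /(_ l)[p pp <-]; exists p; split => // x xa.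
  by rewrite /patch mem_set.
pose phi (c : {ffun 'I_3 * 'I_2 -> R}) : 'I_3 -> 'cV[R]_2 -> 'cV[R]_2 :=
  fun k x => \col_j c (k, j).
have poly_dot v l : is_poly 1 (fun x => dot v (P l x)).
  rewrite (_ : (fun x => _) = fun x => v 0 0 * P l x 0 0 + (v 1 0 * P l x 1 0 + 0)).
    by do 2 (apply: is_poly1_lin; first exact: (hP l).1); exact: is_poly1_cst.
  by apply/funext => x; rewrite dotE addr0.
pose m k l : 'cV[R]_2 := w k *: (P l z + P l (a (k + 1)) + P l (a (k + 2%:R))).
have dE (v : 'I_3 -> 'cV[R]_2) l : dofs2 a z vT l (fun k => cst (v k)) = \sum_k dot (v k) (m k l).
  apply: eq_bigr => k _; rewrite ((hw k).2 _ (fun x => dot (v k) (P l x)))//.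
    by rewrite /m !dotE !mxE; ring.
  by move=> x /(CT_sub a0 za) /(hP l).2 ->.
have dphi c l : dofs2 a z vT l (phi c) = \sum_k dot (\col_j c (k, j)) (m k l).
  exact: (dE (fun k => \col_j c (k, j))).
apply: (@unisolvent_of_injective R _ (@A2 R) _ void _ phi (fun=> 0)).
- by rewrite card_ord.
- by rewrite card_prod !card_ord card_void.
- by move=> k u v; apply/funext => i; apply/funext => x; apply: cV2P; rewrite !mxE !ffunE.
- by move=> k u v; rewrite scaler0 addr0.
- move=> l k u v; rewrite !dphi mulr_sumr -big_split/=; apply: eq_bigr => i _.
  by rewrite !dotE !mxE !ffun_lin; ring.
- move=> c _ k i j; apply/is_poly0P; exists (c (k, i)).
  by apply/funext => x; rewrite mxE.
- move=> u /A2P[v ->]; exists [ffun ij => v ij.1 ij.2 0] => //.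
  apply/funext => k; apply/funext => x; apply/matrixP => j l.
  by rewrite !mxE ffunE ord1.
- move=> c _ c0; apply/ffunP => -[i j]; rewrite ffunE.
  have := congr1 (fun f : 'I_3 -> 'cV[R]_2 -> 'cV[R]_2 => f i 0 j 0) c0.
  by rewrite !mxE.
- move=> u /A2P[v vu] u0.
  have dv l : \sum_k dot (v k) (m k l) = 0.
    by rewrite -dE -vu u0.
  apply/funext => i; rewrite vu (_ : v i = 0)//; apply: dot_eq0.
  (* This test function has mean value zero on the other two subtriangles. *)
  pose q x := (bary a i x - (1 + bary a i z) / 3) *: v i.
  have qp : is_polymx 1 q.
    move=> j l; rewrite (_ : (fun x => _) = fun x =>
        v i j l * (bary a i x) + (- v i j l * ((1 + bary a i z) / 3))); last first.
      by apply/funext => x; rewrite !mxE; ring.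
    by apply: is_poly1_lin; [exact: is_poly1_bary|exact: is_poly1_cst].
  have [c cE] : exists c : 'I_6 -> R, patch (cst 0) (conv_hull a) q = \sum_l c l *: vT l.
    by apply: is_basis_span bT _; exists q.
  have qE x : conv_hull a x -> q x = \sum_l c l *: P l x.
    move=> xa; have := congr1 (fun f : 'cV[R]_2 -> 'cV[R]_2 => f x) cE.
    rewrite /patch mem_set// => ->; rewrite fct_sumE; apply: eq_bigr => l _.
    by rewrite -((hP l).2 x xa).
  have : \sum_k dot (v k) (w k *: (q z + q (a (k + 1)) + q (a (k + 2%:R)))) = 0.
    transitivity (\sum_l c l * \sum_k dot (v k) (m k l)); last first.
      by apply: big1 => l _; rewrite dv mulr0.
    under [RHS]eq_bigr do rewrite mulr_sumr.
    rewrite [RHS]exchange_big/=; apply: eq_bigr => k _.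
    rewrite !qE; [|exact: conv_hull_vertex|exact: conv_hull_vertex|exact: conv_hull_center].
    rewrite -!big_split/= dotE !mxE !summxE !mulr_sumr -big_split/=.
    by apply: eq_bigr => l _; rewrite /m dotE !mxE; ring.
  (* On subtriangle [i] the scalar factor of [q] sums over the vertices to t - (1 + t) = -1; on the
     other two it sums to t + 1 - (1 + t) = 0. *)
  rewrite sum3 /q !(bary_vertex _ _ a0); have wi := (hw i).1.
  move: (bary a i z) => t h.
  have : w i * dot (v i) (v i) = 0.
    move: h; elim/ord3_ind : (i); rewrite !ord3D/= !dotE !mxE; lra.
  by move/eqP; rewrite mulf_eq0 gt_eqF//= => /eqP.
Qed.

End spaces.

(** * Unisolvence for symmetric matrix fields *)

Section stress_space.
Context {R : realType}.
Variables (a : 'I_3 -> 'cV[R]_2) (z : 'cV[R]_2).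
Hypothesis a0 : area2 a != 0.
Hypothesis za : forall j, 0 < bary a j z.
Implicit Types (x y v : 'cV[R]_2).
Local Notation s k := (a k - z).
Local Notation stress_coef := {ffun 'I_3 * 'I_3 * 'I_3 -> R}.

Definition stress (c : stress_coef) : 'I_3 -> 'cV[R]_2 -> 'M[R]_2 :=
  fun i x => sfield (fun e l => c (i, e, l)) (x - z).

(** The boolean selects the end of the spoke: [z] for false, [a k] for true. These are 12 equations
    on 27 coefficients, and 27 = 12 + 15. *)
Definition normal_jumps (c : stress_coef) : {ffun 'I_3 * bool * 'I_2 -> R} :=
  [ffun m : 'I_3 * bool * 'I_2 => let k := m.1.1 in let y := (m.1.2)%:R *: s k in
    ((sfield (fun e l => c (k + 1, e, l)) y -
      sfield (fun e l => c (k + 2%:R, e, l)) y) *m rot (s k)) m.2 0].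

Lemma sfield_ffun_lin (I : finType) (f : 'I_3 -> 'I_3 -> I) k (c d : {ffun I -> R}) y :
  sfield (fun e l => (k *: c + d) (f e l)) y =
  k *: sfield (fun e l => c (f e l)) y + sfield (fun e l => d (f e l)) y.
Proof. by apply: M2P; rewrite !mxE /affine/= !ffun_lin; ring. Qed.

Lemma stress_lin k c d : stress (k *: c + d) = k *: stress c + stress d.
Proof.
apply/funext => i; apply/funext => x; exact: (sfield_ffun_lin (fun e l => (i, e, l))).
Qed.

Lemma normal_jumps_lin k c d :
  normal_jumps (k *: c + d) = k *: normal_jumps c + normal_jumps d.
Proof.
apply/ffunP => -[[i b] j]; rewrite ffun_lin !ffunE /=.
rewrite (sfield_ffun_lin (fun e l => (i + 1, e, l))) (sfield_ffun_lin (fun e l => (i + 2%:R, e, l))).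
by rewrite !mulmxE !mxE /=; ring.
Qed.

Lemma normal_jumps0P c : normal_jumps c = 0 <-> forall k, normal_cont (s k)
  (fun e l => c (k + 1, e, l)) (fun e l => c (k + 2%:R, e, l)).
Proof.
split=> [c0 k t|cn].
  have h (b : bool) : sfield (fun e l => c (k + 1, e, l)) (b%:R *: s k) *m rot (s k) =
      sfield (fun e l => c (k + 2%:R, e, l)) (b%:R *: s k) *m rot (s k).
    apply/eqP; rewrite -subr_eq0 -mulmxBl; apply/eqP/matrixP => j l.
    have := congr1 (fun f : {ffun 'I_3 * bool * 'I_2 -> R} => f (k, b, j)) c0.
    by rewrite ffunE/= ffunE ord1 => ->; rewrite mxE.
  have lin d : sfield d (t *: s k) = (1 - t) *: sfield d (0 *: s k) +
      t *: sfield d (1 *: s k).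
    by rewrite -sfield_lin scale1r scale0r subr0 add0r.
  by rewrite !lin !mulmxDl -!scalemxAl (h false) (h true).
apply/ffunP => -[[k b] j]; rewrite !ffunE/= mulmxBl.
by rewrite (cn k) subrr mxE.
Qed.

Lemma A1_stressP u : A1 a z u <-> exists2 c, normal_jumps c = 0 & stress c = u.
Proof.
have hs := spoke_neq0 a0 za.
split => [/(A1P _ hs)[c [-> cn]]|[c /normal_jumps0P cn <-]].
  exists [ffun m => c m.1.1 m.1.2 m.2].
    apply/normal_jumps0P => k t; have := cn k t.
    by congr (sfield _ _ *m _ = sfield _ _ *m _); apply/funext => e; apply/funext => l; rewrite ffunE.
  apply/funext => i; apply/funext => x; congr (sfield _ _).
  by apply/funext => e; apply/funext => l; rewrite ffunE.
by apply/(A1P _ hs); exists (fun i e l => c (i, e, l)).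
Qed.

Lemma sfield_eq0 c : (forall y, sfield c y = 0) -> forall e l, c e l = 0.
Proof.
move=> c0; have h y i j : sfield c y i j = 0 by rewrite c0 mxE.
pose p (t r : R) : 'cV[R]_2 := \col_i (if i == 0 then t else r).
have haff e y : affine (c e 0, c e 1, c e 2%:R) y = 0.
  by elim/ord3_ind : e; [have := h y 0 0|have := h y 0 1|have := h y 1 1]; rewrite mxE.
move=> e; have := haff e (p 0 0); have := haff e (p 1 0); have := haff e (p 0 1).
rewrite /affine/= !mxE/= => h1 h2 h3.
by elim/ord3_ind; lra.
Qed.

Lemma stress_eq0 c : stress c = 0 -> c = 0.
Proof.
move=> c0; apply/ffunP => -[[i e] l]; rewrite ffunE.
apply: (@sfield_eq0 (fun e l => c (i, e, l))) => y.
have := congr1 (fun f : 'I_3 -> 'cV[R]_2 -> 'M[R]_2 => f i (y + z)) c0.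
by rewrite /stress addrK.
Qed.

Variable nu : 'I_3 -> 'cV[R]_2.
Hypothesis nuP : forall i, unit_normal (nu i) (edge_vec a i).
Variable vE : 'I_3 -> 'I_4 -> 'cV[R]_2 -> 'cV[R]_2.
Hypothesis vEP : forall i, is_basis (P_V 1 (edge a i)) (vE i).
Variable vS : 'I_3 -> 'cV[R]_2 -> 'M[R]_2.
Hypothesis vSP : is_basis (P_S 0 (conv_hull a)) vS.

Let P_exists : exists P : 'I_3 * 'I_4 -> 'cV[R]_2 -> 'cV[R]_2, forall m,
  is_polymx 1 (P m) /\ forall x, edge a m.1 x -> vE m.1 m.2 x = P m x.
Proof.
suff /choice[P hP] : forall m, exists p,
    is_polymx 1 p /\ forall x, edge a m.1 x -> vE m.1 m.2 x = p x by exists P.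
move=> [i l]; have [+ _] := vEP i => /(_ l)[p pp pE]; exists p; split => // x xa.
by rewrite /= -pE /patch mem_set.
Qed.

Let V_exists : exists V : 'I_3 -> 'M[R]_2, forall l,
  (V l)^T = V l /\ forall x, conv_hull a x -> vS l x = V l.
Proof.
suff /choice[V hV] : forall l, exists V : 'M[R]_2,
    V^T = V /\ forall x, conv_hull a x -> vS l x = V by exists V.
move=> l.
have [+ _] := vSP => /(_ l)[p [pp ps] pE].
exists (p 0); split => // x xa; rewrite -pE /patch mem_set//.
apply/matrixP => i j; have /is_poly0P[c cE] := pp i j.
by rewrite (congr1 (fun f => f x) cE) (congr1 (fun f => f 0) cE).
Qed.

Lemma is_polymx_stress_normal (c : 'I_3 -> 'I_3 -> R) v :
  is_polymx 1 (fun x => sfield c (x - z) *m v).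
Proof.
move=> i j; rewrite (_ : (fun x => _) = fun x => v 0 0 * sfield c (x - z) i 0 +
    (v 1 0 * sfield c (x - z) i 1 + 0)).
  do 2 (apply: is_poly1_lin; first exact: is_polymx_sfield); exact: is_poly1_cst.
by apply/funext => x; rewrite ord1 mulmxE; ring.
Qed.

Lemma edge_vertex1 i : edge a i (a (i + 1)).
Proof. by exists 0; rewrite ?edge_pt0//= in_itv/= lexx ler01. Qed.

Lemma edge_vertex2 i : edge a i (a (i + 2%:R)).
Proof. by exists 1; rewrite ?edge_pt1//= in_itv/= lexx ler01. Qed.

Lemma A1_unisolvent : has_dim (A1 a z) 15 /\ unisolvent (A1 a z) (dofs1 a z nu vE vS).
Proof.
have [P hP] := P_exists; have [V hV] := V_exists.
have [w hw] := pw_quadrature a0 za.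
pose E i : R := Num.sqrt (dot (edge_vec a i) (edge_vec a i)) / 6.
pose B (p q p' q' : 'cV[R]_2) := 2 * dot p p' + dot p q' + dot q p' + 2 * dot q q'.
have dE c i l : dofs1 a z nu vE vS (inl (i, l)) (stress c) = E i *
    B (stress c i (a (i + 1)) *m nu i) (stress c i (a (i + 2%:R)) *m nu i)
      (P (i, l) (a (i + 1))) (P (i, l) (a (i + 2%:R))).
  rewrite /= (edge_int_dot (F := fun x => stress c i x *m nu i) (G := P (i, l)))//.
  - exact: is_polymx_stress_normal.
  - exact: (hP (i, l)).1.
  - by move=> x xe; rewrite -((hP (i, l)).2 x xe).
have dS c l : dofs1 a z nu vE vS (inr l) (stress c) = \sum_k w k *
    dot (stress c k z + stress c k (a (k + 1)) + stress c k (a (k + 2%:R))) (V l).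
  rewrite /= /pw_int; apply: eq_bigr => k _.
  rewrite ((hw k).2 _ (fun x => dot (stress c k x) (V l))).
  - by rewrite !dotmxE !mxE; ring.
  - rewrite (_ : (fun x => _) = fun x => V l 0 0 * stress c k x 0 0 +
      (V l 0 1 * stress c k x 0 1 + (V l 1 0 * stress c k x 1 0 +
      (V l 1 1 * stress c k x 1 1 + 0)))).
      do 4 (apply: is_poly1_lin; first exact: is_polymx_sfield); exact: is_poly1_cst.
    by apply/funext => x; rewrite dotmxE; ring.
  - by move=> x /(CT_sub a0 za) /(hV l).2 ->.
apply: (@unisolvent_of_injective R _ (A1 a z) _ _ _ stress normal_jumps).
- by rewrite card_sum card_prod !card_ord.
- by rewrite !card_prod !card_ord card_bool.
- exact: stress_lin.
- exact: normal_jumps_lin.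
- move=> [[i l]|l] k u v.
    by rewrite !dE stress_lin /B !dotE !mulmxE !mxE; ring.
  rewrite !dS mulr_sumr -big_split/=; apply: eq_bigr => i _.
  by rewrite stress_lin !dotmxE !mxE; ring.
- by move=> c c0; apply/A1_stressP; exists c.
- by move=> u /A1_stressP[c c0 cu]; exists c.
- by move=> c _; exact: stress_eq0.
move=> u /A1_stressP[c /normal_jumps0P c0 <-] u0.
(* The normal trace [F] is itself an admissible test field on the edge, so its mass form
   vanishes. *)
have cb i : stress c i (a (i + 1)) *m nu i = 0 /\ stress c i (a (i + 2%:R)) *m nu i = 0.
  pose F x := stress c i x *m nu i.
  have [r rE] : exists r : 'I_4 -> R, patch (cst 0) (edge a i) F = \sum_l r l *: vE i l.
    apply: is_basis_span (vEP i) _; exists F => //; exact: is_polymx_stress_normal.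
  have FE x : edge a i x -> F x = \sum_l r l *: P (i, l) x.
    move=> xa; have := congr1 (fun f : 'cV[R]_2 -> 'cV[R]_2 => f x) rE.
    rewrite /patch mem_set// => ->; rewrite fct_sumE; apply: eq_bigr => l _.
    by rewrite -((hP (i, l)).2 x xa).
  pose p := F (a (i + 1)); pose q := F (a (i + 2%:R)).
  have Bpl l : B p q (P (i, l) (a (i + 1))) (P (i, l) (a (i + 2%:R))) = 0.
    have /eqP := u0 (inl (i, l)); rewrite dE mulf_eq0.
    by rewrite (negbTE (sqrt_edge_neq0 (edge_vec_neq0 a0 i))) => /eqP.
  have : B p q p q = 0.
    transitivity (\sum_l r l * B p q (P (i, l) (a (i + 1))) (P (i, l) (a (i + 2%:R)))).
      rewrite {2}/p {2}/q (FE _ (edge_vertex1 i)) (FE _ (edge_vertex2 i)).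
      rewrite /B !dotE !summxE !mulr_sumr -!big_split/= !mulr_sumr -!big_split/=.
      by apply: eq_bigr => l _; rewrite !dotE !mxE; ring.
    by apply: big1 => l _; rewrite Bpl mulr0.
  rewrite -/(F _) -/p -/(F _) -/q /B !dotE => h.
  (* The mass form is |p + q|^2 + |p|^2 + |q|^2. *)
  have h2 : (p 0 0 + q 0 0) ^+ 2 + (p 1 0 + q 1 0) ^+ 2 +
      p 0 0 ^+ 2 + p 1 0 ^+ 2 + q 0 0 ^+ 2 + q 1 0 ^+ 2 = 0 by rewrite -h; ring.
  have sq (t : R) : t ^+ 2 <= 0 -> t = 0.
    by move=> t0; apply/eqP; rewrite -sqrf_eq0 eq_le t0 sqr_ge0.
  have g1 := sqr_ge0 (p 0 0 + q 0 0); have g2 := sqr_ge0 (p 1 0 + q 1 0).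
  have g3 := sqr_ge0 (p 0 0); have g4 := sqr_ge0 (p 1 0).
  have g5 := sqr_ge0 (q 0 0); have g6 := sqr_ge0 (q 1 0).
  by split; apply: cV2P; rewrite [RHS]mxE; apply: sq; lra.
have cb' i : sfield (fun e l => c (i, e, l)) (s (i + 1)) *m rot (edge_vec a i) = 0 /\
    sfield (fun e l => c (i, e, l)) (s (i + 2%:R)) *m rot (edge_vec a i) = 0.
  have [m m0 nE] := unit_normalP (edge_vec_neq0 a0 i) (nuP i).
  have [h1 h2] := cb i.
  by split; apply: (scalerI m0); rewrite scaler0 scalemxAr -nE.
have [cv cz] := normal_cont_bubble a0 za (c := fun i e l => c (i, e, l)) c0 cb'.
pose U := stress c 0 z.
have UE k : stress c k z = U by rewrite /U /stress subrr; exact: cz.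
have vert k : stress c k (a (k + 1)) = 0 /\ stress c k (a (k + 2%:R)) = 0.
  exact: cv.
have UV l : dot U (V l) = 0.
  have := u0 (inr l); rewrite dS.
  under eq_bigr do rewrite (vert _).1 (vert _).2 !addr0 UE.
  rewrite -mulr_suml => /eqP; rewrite mulf_eq0 gt_eqF/= => [/eqP//|].
  by rewrite sum3; have := (hw 0).1; have := (hw 1).1; have := (hw 2%:R).1; lra.
(* The constant field [U] is an admissible test field, so its Frobenius norm vanishes. *)
have U0 : U = 0.
  have [r rE] : exists r : 'I_3 -> R, patch (cst 0) (conv_hull a) (cst U) = \sum_l r l *: vS l.
    apply: is_basis_span vSP _; exists (cst U) => //; split => [i j|x].
      by apply/is_poly0P; exists (U i j).
    exact: sfield_sym.
  have UE' : U = \sum_l r l *: V l.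
    have := congr1 (fun f : 'cV[R]_2 -> 'M[R]_2 => f z) rE.
    have zT := conv_hull_center a0 za.
    rewrite /patch mem_set// => UE'; rewrite [LHS]UE' fct_sumE; apply: eq_bigr => l _.
    by rewrite -((hV l).2 z zT).
  apply: dotmx_eq0; transitivity (\sum_l r l * dot U (V l)).
    rewrite {2}UE' dotmxE !summxE !mulr_sumr -!big_split/=.
    by apply: eq_bigr => l _; rewrite dotmxE !mxE; ring.
  by apply: big1 => l _; rewrite UV mulr0.
apply/funext => i; apply/funext => x; have [c1 c2] := cv i.
by apply: (sfield_vertices_eq0 a0 za _ c1 c2); rewrite cz -U0 /U /stress subrr.
Qed.

End stress_space.

(** * The complex *)

Section airy_complex.
Context {R : realType}.
Implicit Types (x y z s v : 'cV[R]_2) (k n : @cubic R) (c d : 'I_3 -> 'I_3 -> R).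

Definition airy_coef k : 'I_3 -> 'I_3 -> R := fun e l =>
  let r := if e == 0 then (2 * k02 k, 2 * k12 k, 6 * k03 k)
    else if e == 1 then (- k11 k, - (2 * k21 k), - (2 * k12 k))
    else (2 * k20 k, 6 * k30 k, 2 * k21 k) in
  if l == 0 then r.1.1 else if l == 1 then r.1.2 else r.2.

Definition div_coef c : 'cV[R]_2 :=
  \col_i (if i == 0 then c 0 1 + c 1 2%:R else c 1 1 + c 2%:R 2%:R).

(* An Airy potential when [c] is divergence-free; [p] is its 1-jet at the origin. *)
Definition potential (p : R * R * R) c : cubic :=
  Cubic p.1.1 p.1.2 p.2 (c 2%:R 0 / 2) (- c 1 0) (c 0 0 / 2)
    (c 2%:R 1 / 6) (c 2%:R 2%:R / 2) (c 0 1 / 2) (c 0 2%:R / 6).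

Lemma airy_cub (k : 'I_3 -> cubic) z : airy (fun i x => cub (k i) (x - z)) =
  fun i x => sfield (airy_coef (k i)) (x - z).
Proof.
apply/funext => i; apply/funext => x.
by apply: M2P; rewrite !mxE/= !partial_cub /cub /affine/airy_coef/=; ring.
Qed.

Lemma divergence_sfield (c : 'I_3 -> 'I_3 -> 'I_3 -> R) z :
  divergence (fun i x => sfield (c i) (x - z)) = fun i _ => div_coef (c i).
Proof.
apply/funext => i; apply/funext => x.
have h (e1 e2 : 'I_3) (i1 : 'I_2) :
    (forall y, sfield (c i) y i1 0 = affine (c i e1 0, c i e1 1, c i e1 2%:R) y) ->
    (forall y, sfield (c i) y i1 1 = affine (c i e2 0, c i e2 1, c i e2 2%:R) y) ->
    partial 0 (fun y => sfield (c i) (y - z) i1 0) x + partial 1 (fun y => sfield (c i) (y - z) i1 1) x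
    = c i e1 1 + c i e2 2%:R.
  move=> h1 h2; under [fun y => sfield _ _ _ 0]eq_fun do rewrite h1 affine_cub.
  under [fun y => sfield _ _ _ 1]eq_fun do rewrite h2 affine_cub.
  by rewrite !partial_cub /cub/=; ring.
by apply: cV2P; rewrite !mxE sum2/=; apply: h => // y; rewrite mxE.
Qed.

Lemma div_coef_airy k : div_coef (airy_coef k) = 0.
Proof. by apply: cV2P; rewrite !mxE/= /airy_coef/=; ring. Qed.

Lemma div_coef0 c : div_coef c = 0 -> (c 1 2%:R = - c 0 1) * (c 1 1 = - c 2%:R 2%:R).
Proof.
move=> c0; have := congr1 (fun w : 'cV[R]_2 => w 0 0) c0.
by have := congr1 (fun w : 'cV[R]_2 => w 1 0) c0; rewrite !mxE/= => h1 h0; split; lra.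
Qed.

Lemma airy_coef_potential p c : div_coef c = 0 -> airy_coef (potential p c) = c.
Proof.
move=> /div_coef0 c0; apply/funext => e; apply/funext => l.
by elim/ord3_ind : e; elim/ord3_ind : l; rewrite /airy_coef/= ?c0; field.
Qed.

Lemma potential_airy_coef k :
  potential (k00 k, k10 k, k01 k) (airy_coef k) = k.
Proof. by case: k => *; rewrite /potential/=; congr Cubic; rewrite /airy_coef/=; field. Qed.

(** The product of the Airy field with [rot s] is, up to a quarter turn, the derivative of the
    gradient along [s]. It is affine, so the midpoint rule recovers the gradient at [t *: s] from
    its value at half the distance. *)
Lemma C1_across_potential s p c d : div_coef c = 0 -> div_coef d = 0 ->
  normal_cont s c d -> C1_across s (potential p c) (potential p d).
Proof.
move=> c0 d0 cd; split => [|j t]; first by rewrite /cub/= !mxE; ring.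
have h e : div_coef e = 0 -> cub (dcub j (potential p e)) (t *: s) =
    (if j == 0 then p.1.2 else p.2) + t * (if j == 0 then 1 else - 1) *
    (sfield e ((t / 2) *: s) *m rot s) (if j == 0 then 1 else 0) 0.
  move=> /div_coef0 e0; elim/ord2_ind : j => /=;
    by rewrite mulmxE !mxE /cub /affine/= !mxE/= ?e0; field.
by rewrite !h// cd.
Qed.

Lemma rotN v : rot (- v) = - rot v.
Proof. by apply: cV2P; rewrite !mxE/= ?mxE. Qed.

(* The gradient is quadratic, so three values on a line determine its
   derivative along that line. *)
Lemma derive_along k y v j :
  4 * cub (dcub j k) (y + 2^-1 *: v) - 3 * cub (dcub j k) y - cub (dcub j k) (y + v) =
  (if j == 0 then 1 else - 1) *
    (sfield (airy_coef k) y *m rot v) (if j == 0 then 1 else 0) 0.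
Proof.
by elim/ord2_ind : j => /=; rewrite mulmxE !mxE /cub /affine/airy_coef/= !mxE/=; field.
Qed.

(** On a segment a cubic is fixed by its values and tangential derivatives at the ends; this is the
    derivative of the Hermite interpolant at the midpoint. *)
Lemma tangential_mid k y v :
  v 0 0 * cub (dcub 0 k) (y + 2^-1 *: v) + v 1 0 * cub (dcub 1 k) (y + 2^-1 *: v) =
  3 / 2 * (cub k (y + v) - cub k y) -
  4^-1 * (v 0 0 * (cub (dcub 0 k) y + cub (dcub 0 k) (y + v)) +
          v 1 0 * (cub (dcub 1 k) y + cub (dcub 1 k) (y + v))).
Proof. by rewrite /cub/= !mxE; field. Qed.

Lemma along_eq0 k y v : (forall j, cub (dcub j k) y = 0) ->
  (forall j, cub (dcub j k) (y + 2^-1 *: v) = 0) ->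
  (forall j, cub (dcub j k) (y + v) = 0) ->
  sfield (airy_coef k) y *m rot v = 0.
Proof.
move=> h1 h2 h3; apply: cV2P; rewrite [RHS]mxE.
- by have := derive_along k y v 1; rewrite h1 h2 h3/=; lra.
- by have := derive_along k y v 0; rewrite h1 h2 h3/=; lra.
Qed.

(** Equality of gradients is differentiated along the spoke by means of three points of its line, at
    t, t + 1/2 and t + 1. *)
Lemma normal_cont_airy s k n : C1_across s k n ->
  normal_cont s (airy_coef k) (airy_coef n).
Proof.
move=> [_ kn] t.
have h j m := derive_along m (t *: s) s j.
have e1 : t *: s + s = (t + 1) *: s by rewrite scalerDl scale1r.
have e2 : t *: s + 2^-1 *: s = (t + 2^-1) *: s by rewrite scalerDl.
apply: cV2P.
- by have := h 1 k; rewrite e1 e2 !kn -e1 -e2 h/=; lra.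
- by have := h 0 k; rewrite e1 e2 !kn -e1 -e2 h/=; lra.
Qed.

(* With [f] and [f'] the hat functions of [p] and [q] on the triangle [0, p, q],
   this is the combination of [f p p^T] and [f' q q^T] that has divergence [v]. *)
Definition div_bubble p q v : 'I_3 -> 'I_3 -> R :=
  let m := cr p q in let g := cr v q / m ^+ 2 in let h := cr p v / m ^+ 2 in
  let r (t t' : R) := (0, g * q 1 0 * t - h * p 1 0 * t', h * p 0 0 * t' - g * q 0 0 * t) in
  fun e l => let w := if e == 0 then r (p 0 0 ^+ 2) (q 0 0 ^+ 2)
    else if e == 1 then r (p 0 0 * p 1 0) (q 0 0 * q 1 0)
    else r (p 1 0 ^+ 2) (q 1 0 ^+ 2) in
  if l == 0 then w.1.1 else if l == 1 then w.1.2 else w.2.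

(** Along [p] the hat function of [q] vanishes, and p p^T annihilates [rot p]. *)
Lemma div_bubble_normal1 p q v t : sfield (div_bubble p q v) (t *: p) *m rot p = 0.
Proof. by apply: cV2P; rewrite mulmxE !mxE /affine/div_bubble/= !mxE/=; ring. Qed.

Lemma div_bubble_normal2 p q v t : sfield (div_bubble p q v) (t *: q) *m rot q = 0.
Proof. by apply: cV2P; rewrite mulmxE !mxE /affine/div_bubble/= !mxE/=; ring. Qed.

Lemma div_coef_bubble p q v : cr p q != 0 -> div_coef (div_bubble p q v) = v.
Proof.
by move=> pq; apply: cV2P; rewrite !mxE/= /div_bubble/=; move: pq; rewrite /cr => pq; field.
Qed.

(** On a triangle 0, p, q the field (g, h) is its value at 0 times the hat function of 0, whose
    gradient is normal to [q - p]; zero divergence thus makes that value orthogonal to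
    [rot (q - p)]. The identity used also covers dependent p and q. *)
Lemma div_free_row (g h : R * R * R) p q : g.1.2 + h.2 = 0 ->
  affine g p = 0 -> affine h p = 0 -> affine g q = 0 -> affine h q = 0 ->
  h.1.1 * (q - p) 0 0 - g.1.1 * (q - p) 1 0 = 0.
Proof.
move=> gh gp hp gq hq; pose e := q - p.
transitivity (affine h p * e 0 0 - affine g p * e 1 0 -
  p 0 0 * (affine h q - affine h p) + p 1 0 * (affine g q - affine g p) +
  (g.1.2 + h.2) * (p 0 0 * e 1 0 - p 1 0 * e 0 0)); last first.
  by rewrite gh gp hp gq hq; ring.
by rewrite /affine /e !mxE; ring.
Qed.

Lemma div_free_normal c p q : div_coef c = 0 -> sfield c p = 0 -> sfield c q = 0 ->
  sfield c 0 *m rot (q - p) = 0.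
Proof.
move=> c0 cp cq.
have hp e : affine (c e 0, c e 1, c e 2%:R) p = 0.
  have h i j : sfield c p i j = 0 by rewrite cp mxE.
  by elim/ord3_ind : e; [have := h 0 0|have := h 0 1|have := h 1 1]; rewrite mxE.
have hq e : affine (c e 0, c e 1, c e 2%:R) q = 0.
  have h i j : sfield c q i j = 0 by rewrite cq mxE.
  by elim/ord3_ind : e; [have := h 0 0|have := h 0 1|have := h 1 1]; rewrite mxE.
have d0 : c 0 1 + c 1 2%:R = 0 by have := congr1 (fun w : 'cV[R]_2 => w 0 0) c0; rewrite !mxE.
have d1 : c 1 1 + c 2%:R 2%:R = 0 by have := congr1 (fun w : 'cV[R]_2 => w 1 0) c0; rewrite !mxE.
have r0 := div_free_row (g := (_, _, _)) (h := (_, _, _)) d0 (hp 0) (hp 1) (hq 0) (hq 1).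
have r1 := div_free_row (g := (_, _, _)) (h := (_, _, _)) d1 (hp 1) (hp 2%:R) (hq 1) (hq 2%:R).
move: r0 r1; rewrite !mxE/= => r0 r1.
by apply: cV2P; rewrite mulmxE !mxE /affine/= !mxE; lra.
Qed.

End airy_complex.

(** * Exactness of the complex, and unisolvence for scalar fields *)

Section exactness.
Context {R : realType}.
Variables (a : 'I_3 -> 'cV[R]_2) (z : 'cV[R]_2).
Hypothesis a0 : area2 a != 0.
Hypothesis za : forall j, 0 < bary a j z.
Implicit Types (x y v : 'cV[R]_2).
Local Notation s k := (a k - z).

Lemma ord3_cst (T : Type) (f : 'I_3 -> T) : (forall k, f (k + 1) = f (k + 2%:R)) ->
  forall i, f i = f 0.
Proof.
move=> h; elim/ord3_ind => //.
- by have := h 2%:R; rewrite !ord3D.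
- by have := h 1; rewrite !ord3D.
Qed.

(** A piece without Airy stress reduces to its 1-jet at [z], and the pieces share this jet because
    [z] lies on every spoke. *)
Lemma airy_kernel : (fun p (_ : 'I_3) => p) @` @is_poly R 1 =
  A0 a z `&` [set u | airy u = 0].
Proof.
apply/seteqP; split=> [_ [f /(is_poly1P z)[p ->] <-]|u [/(A0P a0 za)[k [-> kk]] /= u0]].
  have E : (fun=> (fun x => affine p (x - z))) = (fun (i : 'I_3) x =>
      cub (Cubic p.1.1 p.1.2 p.2 0 0 0 0 0 0 0) (x - z)).
    by apply/funext => i; apply/funext => x; rewrite affine_cub.
  rewrite E; split; first by apply/(A0P a0 za); exists (fun=> Cubic p.1.1 p.1.2 p.2 0 0 0 0 0 0 0).
  rewrite /= airy_cub; apply/funext => i; apply/funext => x.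
  by apply: M2P; rewrite !mxE /affine/airy_coef/=; ring.
have k0 i : forall e l, airy_coef (k i) e l = 0.
  apply: sfield_eq0 => y; have := congr1 (fun f : 'I_3 -> 'cV[R]_2 -> 'M[R]_2 => f i (y + z)) u0.
  by rewrite airy_cub addrK.
pose p i := (k00 (k i), k10 (k i), k01 (k i)).
have pE i : p i = p 0.
  apply: ord3_cst => {}i; have [h0 h1] := kk i.
  have := h1 0 0; have := h1 1 0; move: h0.
  by rewrite scale0r /cub/= !mxE !mulr0 !expr0n/= !mulr0 !addr0 /p => -> -> ->.
exists (fun x => affine (p 0) (x - z)); first by apply/(is_poly1P z); exists (p 0).
apply/funext => i; apply/funext => x; rewrite -(pE i) affine_cub -(potential_airy_coef (k i)).
by rewrite /cub/potential/= !k0; ring.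
Qed.

Lemma airy_image : @airy R @` A0 a z = A1 a z `&` [set u | divergence u = 0].
Proof.
have hs := spoke_neq0 a0 za.
apply/seteqP; split=> [_ [u /(A0P a0 za)[k [-> kk]] <-]|u [/(A1P _ hs)[c [-> cc]] /= u0]].
  rewrite airy_cub; split.
    apply/(A1P _ hs); exists (fun i => airy_coef (k i)); split => // i.
    exact: normal_cont_airy.
  rewrite /= divergence_sfield; apply/funext => i; apply/funext => x.
  exact: div_coef_airy.
have c0 i : div_coef (c i) = 0.
  have := congr1 (fun f : 'I_3 -> 'cV[R]_2 -> 'cV[R]_2 => f i 0) u0.
  by rewrite divergence_sfield.
exists (fun i x => cub (potential (0, 0, 0) (c i)) (x - z)).
  apply/(A0P a0 za); exists (fun i => potential (0, 0, 0) (c i)); split => // i.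
  exact: C1_across_potential.
rewrite airy_cub; apply/funext => i; apply/funext => x.
by rewrite airy_coef_potential.
Qed.

Lemma divergence_image : @divergence R @` A1 a z = @A2 R.
Proof.
have hs := spoke_neq0 a0 za.
apply/seteqP; split=> [_ [u /(A1P _ hs)[c [-> _]] <-] i j l|_ /A2P[v ->]].
  by apply/is_poly0P; exists (div_coef (c i) j l); rewrite divergence_sfield.
(* Each piece has zero normal component on both of its spokes, so the pieces need no matching. *)
pose c i := div_bubble (s (i + 1)) (s (i + 2%:R)) (v i).
exists (fun i x => sfield (c i) (x - z)).
  apply/(A1P _ hs); exists c; split => // k t; rewrite /c !ord3DA.
  by rewrite div_bubble_normal2 div_bubble_normal1.
rewrite divergence_sfield; apply/funext => i; apply/funext => x.
exact/div_coef_bubble/cr_spoke_neq0.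
Qed.

Variable nu : 'I_3 -> 'cV[R]_2.
Hypothesis nuP : forall i, unit_normal (nu i) (edge_vec a i).

Local Notation scalar_coef := {ffun 'I_3 + 'I_3 * 'I_3 * 'I_3 -> R}.

(* The coefficients are the common 1-jet of the pieces at [z] and their three
   Airy stresses. *)
Definition pieces (c : scalar_coef) i : cubic :=
  potential (c (inl 0), c (inl 1), c (inl 2%:R)) (fun e l => c (inr (i, e, l))).

Definition scalar_field c : 'I_3 -> 'cV[R]_2 -> R := fun i x => cub (pieces c i) (x - z).

Definition stress_part (c : scalar_coef) : {ffun 'I_3 * 'I_3 * 'I_3 -> R} :=
  [ffun m => c (inr m)].

(** The stresses must be normally continuous (12 equations) and divergence-free (6 equations), so
    that potentials exist and match; on 30 coefficients, 30 = 18 + 12. *)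
Definition scalar_constraints (c : scalar_coef) :
    {ffun 'I_3 * bool * 'I_2 + 'I_3 * 'I_2 -> R} :=
  [ffun m => match m with
    | inl m => normal_jumps a z (stress_part c) m
    | inr m => div_coef (fun e l => c (inr (m.1, e, l))) m.2 0 end].

Lemma cub_pieces_lin t c d i y : cub (pieces (t *: c + d) i) y =
  t * cub (pieces c i) y + cub (pieces d i) y.
Proof. by rewrite /cub /pieces/= !ffun_lin; field. Qed.

Lemma dcub_pieces_lin t c d i j y : cub (dcub j (pieces (t *: c + d) i)) y =
  t * cub (dcub j (pieces c i)) y + cub (dcub j (pieces d i)) y.
Proof. by elim/ord2_ind : j; rewrite /cub /pieces/= !ffun_lin; field. Qed.

Lemma scalar_constraints0P c : scalar_constraints c = 0 <->
  (forall k, normal_cont (s k) (fun e l => c (inr (k + 1, e, l)))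
     (fun e l => c (inr (k + 2%:R, e, l)))) /\
  forall i, div_coef (fun e l => c (inr (i, e, l))) = 0.
Proof.
have E k : (fun e l => stress_part c (k, e, l)) = (fun e l => c (inr (k, e, l))).
  by apply/funext => e; apply/funext => l; rewrite ffunE.
have nE : normal_jumps a z (stress_part c) = 0 <->
    forall k, normal_cont (s k) (fun e l => c (inr (k + 1, e, l)))
     (fun e l => c (inr (k + 2%:R, e, l))).
  rewrite normal_jumps0P//; split=> h k; have := h k; by rewrite !E.
rewrite -nE; split=> [c0|[c0 d0]].
  have h m := congr1 (fun f : {ffun 'I_3 * bool * 'I_2 + 'I_3 * 'I_2 -> R} => f m) c0.
  split; first by apply/ffunP => m; have := h (inl m); rewrite !ffunE.
  move=> i; apply/matrixP => j l; have := h (inr (i, j)).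
  by rewrite !ffunE !mxE.
apply/ffunP => -[m|[i j]]; rewrite ffunE; first by rewrite c0 !ffunE.
by rewrite d0 !mxE ffunE.
Qed.

Lemma A0_scalar_fieldP u : A0 a z u <->
  exists2 c, scalar_constraints c = 0 & scalar_field c = u.
Proof.
split=> [/(A0P a0 za)[k [-> kk]]|[c /scalar_constraints0P[cn cd] <-]]; last first.
  apply/(A0P a0 za); exists (pieces c); split => // i.
  exact: C1_across_potential.
pose c : scalar_coef := [ffun m => match m with
  | inl l => if l == 0 then k00 (k 0) else if l == 1 then k10 (k 0) else k01 (k 0)
  | inr m => airy_coef (k m.1.1) m.1.2 m.2 end].
have E i : (fun e l => c (inr (i, e, l))) = airy_coef (k i).
  by apply/funext => e; apply/funext => l; rewrite ffunE.
exists c.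
  apply/scalar_constraints0P; split => [i|i]; rewrite !E; last exact: div_coef_airy.
  exact: normal_cont_airy.
apply/funext => i; rewrite /scalar_field /pieces E !ffunE/=.
suff -> : (k00 (k 0), k10 (k 0), k01 (k 0)) = (k00 (k i), k10 (k i), k01 (k i)).
  by rewrite potential_airy_coef.
apply/esym; apply: (@ord3_cst _ (fun i => (k00 (k i), k10 (k i), k01 (k i)))) => {}i.
have [h0 h1] := kk i.
have := h1 0 0; have := h1 1 0; move: h0.
by rewrite scale0r /cub/= !mxE !mulr0 !expr0n/= !mulr0 !addr0 => -> -> ->.
Qed.

Lemma A0_unisolvent : has_dim (A0 a z) 12 /\ unisolvent (A0 a z) (dofs0 a nu).
Proof.
pose N (k : 'I_3 -> cubic) i x : R :=
  nu i 0 0 * cub (dcub 0 (k i)) (x - z) + nu i 1 0 * cub (dcub 1 (k i)) (x - z).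
pose E i : R := Num.sqrt (dot (edge_vec a i) (edge_vec a i)) / 6.
pose mid i := edge_pt a i 2^-1.
have dN k i : dofs0 a nu (inr i) (fun i x => cub (k i) (x - z)) =
    E i * (N k i (a (i + 1)) + 4 * N k i (mid i) + N k i (a (i + 2%:R))).
  rewrite /= (@edge_int_quadratic _ a i _ (N k i)).
  - by rewrite edge_pt0 edge_pt1 /E; field.
  - pose p := a (i + 1) - z; pose e := edge_vec a i.
    have pe t : edge_pt a i t - z = p + t *: e by rewrite /edge_pt /seg /p -/(edge_vec a i) addrAC.
    have q (j : 'I_2) : exists q0 q1 q2, forall t, cub (dcub j (k i)) (p + t *: e) = q0 + q1 * t + q2 * t ^+ 2.
      pose P t := cub (dcub j (k i)) (p + t *: e).
      (* Coefficients of the quadratic interpolating at 0, 1/2 and 1. *)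
      exists (P 0), (4 * P 2^-1 - 3 * P 0 - P 1), (2 * P 0 + 2 * P 1 - 4 * P 2^-1) => t.
      by rewrite /P; elim/ord2_ind : j {P} => /=; rewrite /cub/= !mxE; field.
    have [q0 [q1 [q2 qE]]] := q 0; have [r0 [r1 [r2 rE]]] := q 1.
    exists (nu i 0 0 * q0 + nu i 1 0 * r0), (nu i 0 0 * q1 + nu i 1 0 * r1),
      (nu i 0 0 * q2 + nu i 1 0 * r2) => t.
    by rewrite /N pe qE rE; ring.
  - by move=> t _; rewrite derive_cub.
have dV k m : dofs0 a nu (inl (inl m)) (fun i x => cub (k i) (x - z)) = cub (k (m + 1)) (s m).
  by [].
have dG k m j : dofs0 a nu (inl (inr (m, j))) (fun i x => cub (k i) (x - z)) =
    cub (dcub j (k (m + 1))) (s m).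
  by rewrite /= partial_cub.
apply: (@unisolvent_of_injective R _ (A0 a z) _ _ _ scalar_field scalar_constraints).
- by rewrite !card_sum !card_prod !card_ord.
- by rewrite !card_sum !card_prod !card_ord card_bool.
- move=> t c d; apply/funext => i; apply/funext => x.
  exact: cub_pieces_lin.
- move=> t c d; have cl e m : scalar_constraints e (inl m) = normal_jumps a z (stress_part e) m.
    by rewrite ffunE.
  have cr e i j : scalar_constraints e (inr (i, j)) =
      div_coef (fun n l => e (inr (i, n, l))) j 0 by rewrite ffunE.
  have sp : stress_part (t *: c + d) = t *: stress_part c + stress_part d.
    by apply/ffunP => n; rewrite ffun_lin !ffunE.
  apply/ffunP => -[m|[i j]]; rewrite ffun_lin.
    by rewrite !cl sp normal_jumps_lin ffun_lin.
  by rewrite !cr !mxE !ffun_lin /=; case: ifP => _; ring.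
- move=> [[m|[m j]]|i] t c d.
  + by rewrite !dV cub_pieces_lin.
  + by rewrite !dG dcub_pieces_lin.
  + by rewrite !dN /N !dcub_pieces_lin; ring.
- by move=> c c0; apply/A0_scalar_fieldP; exists c.
- by move=> u /A0_scalar_fieldP[c c0 cu]; exists c.
- move=> c /scalar_constraints0P[_ cd] c0.
  (* For divergence-free stresses the Airy operator inverts [potential], so the stresses can be read
     off the zero field. *)
  have k0 : stress_part c = 0.
    apply: (@stress_eq0 _ z); rewrite -[RHS](_ : airy (scalar_field c) = 0).
      rewrite airy_cub; apply/funext => i; apply/funext => x; rewrite /stress /pieces.
      rewrite airy_coef_potential//; congr (sfield _ _).
      by apply/funext => e; apply/funext => l; rewrite ffunE.
    rewrite c0 (_ : 0 = fun i x => cub (Cubic 0 0 0 0 0 0 0 0 0 0) (x - z)).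
      rewrite airy_cub; apply/funext => i; apply/funext => x.
      by apply: M2P; rewrite !mxE /affine/airy_coef/=; ring.
    by apply/funext => i; apply/funext => x; rewrite -[LHS]/(0 : R) /cub/=; ring.
  have i0 m : c (inr m) = 0.
    by have := congr1 (fun f : {ffun 'I_3 * 'I_3 * 'I_3 -> R} => f m) k0; rewrite !ffunE.
  pose pt2 (t r : R) : 'cV[R]_2 := \col_i (if i == 0 then t else r).
  have h t r : cub (pieces c 0) (pt2 t r) = 0.
    transitivity (scalar_field c 0 (pt2 t r + z)); last by rewrite c0.
    by rewrite /scalar_field addrK.
  have := h 0 0; have := h 1 0; have := h 0 1.
  rewrite /cub/= !i0 !mxE/= => h1 h2 h3.
  apply/ffunP => -[l|m]; rewrite ffunE; last exact: i0.
  by elim/ord3_ind : l; lra.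
move=> u /(A0P a0 za)[k [-> kk]] u0.
(* The vertex DoFs read piece m + 1 at [a m]; smoothness across the spoke carries the zeros to piece
   m + 2. *)
have vert i : (cub (k i) (s (i + 1)) = 0 /\ cub (k i) (s (i + 2%:R)) = 0) /\
    forall j, cub (dcub j (k i)) (s (i + 1)) = 0 /\ cub (dcub j (k i)) (s (i + 2%:R)) = 0.
  have h1 m : cub (k (m + 1)) (s m) = 0 by rewrite -dV u0.
  have h2 m j : cub (dcub j (k (m + 1))) (s m) = 0 by rewrite -dG u0.
  have h3 m : cub (k (m + 2%:R)) (s m) = 0.
    by rewrite -(h1 m) -[s m]scale1r (C1_across_val 1 (kk m)).
  have h4 m j : cub (dcub j (k (m + 2%:R))) (s m) = 0.
    by rewrite -(h2 m j) -[s m]scale1r; have [_ ->] := kk m.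
  by split => [|j]; split; [have := h3 (i + 1)|have := h1 (i + 2%:R)|
    have := h4 (i + 1) j|have := h2 (i + 2%:R) j]; rewrite ord3DA.
have midE i : mid i - z = s (i + 1) + 2^-1 *: edge_vec a i.
  by rewrite /mid /edge_pt /seg -/(edge_vec a i) addrAC.
have endE i : s (i + 2%:R) = s (i + 1) + edge_vec a i.
  by apply: cV2P; rewrite !mxE; ring.
(* With zero data at both ends, Simpson's rule in the edge DoF gives the normal part of the gradient
   at the midpoint, and Hermite interpolation the tangential part. *)
have grad_mid i j : cub (dcub j (k i)) (mid i - z) = 0.
  have [[v1 v2] g] := vert i; have [g01 g02] := g 0; have [g11 g12] := g 1.
  pose G : 'cV[R]_2 := \col_j cub (dcub j (k i)) (mid i - z).
  have GE l : G l 0 = cub (dcub l (k i)) (mid i - z) by rewrite mxE.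
  suff G0 : G = 0 by rewrite -GE G0 mxE.
  apply: (@cr_neq0_dot_eq0 _ (nu i) (edge_vec a i)).
  - have [m m0 ->] := unit_normalP (edge_vec_neq0 a0 i) (nuP i).
    have : dot (edge_vec a i) (edge_vec a i) != 0.
      by rewrite (contra_neq (@dot_eq0 _ _) (edge_vec_neq0 a0 i)).
    move=> ee; rewrite (_ : cr _ _ = - (m * dot (edge_vec a i) (edge_vec a i))).
      by rewrite oppr_eq0 mulf_neq0.
    by rewrite /cr dotE !mxE/=; ring.
  - have := u0 (inr i); rewrite dN => /eqP.
    rewrite mulf_eq0 (negbTE (sqrt_edge_neq0 (edge_vec_neq0 a0 i)))/= => /eqP.
    by rewrite /N g01 g02 g11 g12 dotE !GE; lra.
  - have : dot (edge_vec a i) G = 3 / 2 * (cub (k i) (s (i + 2%:R)) - cub (k i) (s (i + 1)))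
      - 4^-1 * (edge_vec a i 0 0 * (cub (dcub 0 (k i)) (s (i + 1)) + cub (dcub 0 (k i)) (s (i + 2%:R)))
      + edge_vec a i 1 0 * (cub (dcub 1 (k i)) (s (i + 1)) + cub (dcub 1 (k i)) (s (i + 2%:R)))).
      by rewrite dotE !GE midE endE; exact: tangential_mid.
    by move=> ->; rewrite v1 v2 g01 g02 g11 g12; ring.
have tang i : sfield (airy_coef (k i)) (s (i + 1)) *m rot (edge_vec a i) = 0 /\
    sfield (airy_coef (k i)) (s (i + 2%:R)) *m rot (edge_vec a i) = 0.
  have h j : cub (dcub j (k i)) (s (i + 1)) = 0 /\ cub (dcub j (k i)) (s (i + 2%:R)) = 0.
    exact: (vert i).2.
  have h' j : cub (dcub j (k i)) (s (i + 1) + 2^-1 *: edge_vec a i) = 0.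
    by rewrite -midE grad_mid.
  split; first by apply: along_eq0 => j; rewrite ?h' -?endE; case: (h j).
  (* The second end is treated by running along the edge backwards. *)
  rewrite -[edge_vec a i]opprK rotN mulmxN along_eq0 ?oppr0// => j.
  - by case: (h j).
  - rewrite (_ : _ + _ *: _ = s (i + 1) + 2^-1 *: edge_vec a i) ?h'//.
    by rewrite endE; apply: cV2P; rewrite !mxE; field.
  - by rewrite endE addrK; case: (h j).
have [cv cz] := normal_cont_bubble a0 za (c := fun i => airy_coef (k i))
  (fun m => normal_cont_airy (kk m)) tang.
(* The common value at [z] annihilates the normals of all three edges by zero divergence, and two of
   these normals are independent. *)
have U0 : sfield (airy_coef (k 0)) 0 = 0.
  have h i : sfield (airy_coef (k 0)) 0 *m rot (edge_vec a i) = 0.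
    have [c1 c2] := cv i; rewrite -(cz i).
    have := div_free_normal (div_coef_airy (k i)) c1 c2.
    by rewrite endE [s (i + 1) + _]addrC addrK.
  by apply: (mulmx_cr_eq0 _ (h (0 + 1)) (h (0 + 2%:R))); rewrite cr_rot cr_edges.
have k0 i : forall e l, airy_coef (k i) e l = 0.
  have [c1 c2] := cv i; apply: sfield_eq0.
  by apply: (sfield_vertices_eq0 a0 za _ c1 c2); rewrite cz.
(* Without Airy stress the piece is affine, and its value and gradient vanish at a vertex. *)
apply/funext => i; apply/funext => x.
have [[v1 v2] g] := vert i; have [g01 _] := g 0; have [g11 _] := g 1.
move: v1 g01 g11; rewrite -(potential_airy_coef (k i)) /cub/potential/= !k0 => v1 g01 g11.
rewrite -[RHS]/(0 : R).
have e10 : k10 (k i) = 0 by lra.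
have e01 : k01 (k i) = 0 by lra.
by move: v1; rewrite e10 e01; lra.
Qed.

End exactness.

Theorem theorem5p2 (R : realType) (a : 'I_3 -> 'cV[R]_2) (z : 'cV[R]_2)
    (nu : 'I_3 -> 'cV[R]_2)
    (vE : 'I_3 -> 'I_4 -> 'cV[R]_2 -> 'cV[R]_2)
    (vS : 'I_3 -> 'cV[R]_2 -> 'M[R]_2)
    (vT : 'I_6 -> 'cV[R]_2 -> 'cV[R]_2) :
  nondegenerate_triangle a ->
  (conv_hull a)° z ->
  (forall i, unit_normal (nu i) (edge_vec a i)) ->
  (forall i, is_basis (P_V 1 (edge a i)) (vE i)) ->
  is_basis (P_S 0 (conv_hull a)) vS ->
  is_basis (P_V 1 (conv_hull a)) vT ->
  [/\ has_dim (A0 a z) 12 /\ unisolvent (A0 a z) (dofs0 a nu),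
      has_dim (A1 a z) 15 /\ unisolvent (A1 a z) (dofs1 a z nu vE vS),
      has_dim (@A2 R) 6 /\ unisolvent (@A2 R) (dofs2 a z vT) &
      (* 0 -> P^1(T, R) -> A0 -> A1 -> A2 -> 0 *)
      let incl : ('cV[R]_2 -> R) -> 'I_3 -> 'cV[R]_2 -> R := fun p _ => p in
      [/\ {in @is_poly R 1 &, injective incl},
          incl @` @is_poly R 1 = A0 a z `&` [set u | airy u = 0],
          @airy R @` A0 a z = A1 a z `&` [set u | divergence u = 0] &
          @divergence R @` A1 a z = @A2 R]].
Proof.
move=> /free_cr a0 zT nuP vEP vSP vTP.
have za j := interior_bary j a0 zT.
split; first exact: A0_unisolvent.
- exact: A1_unisolvent.
- exact: A2_unisolvent.
split; last exact: divergence_image.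
- by move=> p q _ _ /(congr1 (fun f => f 0)).
- exact: airy_kernel.
- exact: airy_image.
Qed.
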